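(* Let $M$ be a spacelike surface in $\mathbb{R}^{3,1}$ with a canonical normal null direction $Z$, where $Z$ is a unit spacelike parallel vector field on $\mathbb{R}^{3,1}$, such that $a=0$ and $\beta(Z^\top)=0$. Then the surface $M$ can be parametrized by $$\psi(x,y)=\alpha(y)+x\,Z^\top(y),$$ where $\alpha$ is a curve in $\mathbb{R}^{3,1}$ and $Z^\top(y)$ denotes the restriction of $Z^\top$ on $\alpha$.
   Context: $\mathbb{R}^{3,1}$ is $\mathbb{R}^4$ with the metric $\langle\cdot,\cdot\rangle=dx_1^2+dx_2^2+dx_3^2-dx_4^2$. A surface $M\subset\mathbb{R}^{3,1}$ is spacelike if the induced metric is Riemannian. For a parallel vector field $Z$ on $\mathbb{R}^{3,1}$ write $Z=Z^\top+Z^\perp$ for its tangent and normal parts along $M$. $M$ has a canonical normal null direction with respect to $Z$ if $Z^\perp$ is a lightlike normal vector field on $M$. Since $Z$ is unit spacelike and $\langle Z^\perp,Z^\perp\rangle=0$, one has $\langle Z^\top,Z^\top\rangle=1$. $B(X,Y)=\overline\nabla_XY-\nabla_XY$ is the second fundamental form, where $\overline\nabla$, $\nabla$ are the Levi-Civita connections of $\mathbb{R}^{3,1}$ and $M$. $W$ is the unit spacelike vector field tangent to $M$ with $\langle Z^\top,W\rangle=0$ and $(Z^\top,W)$ positively oriented. The function $a$ on $M$ is $a=\langle B(W,W),Z^\perp\rangle$. The 1-form $\beta$ on $M$ is defined by $B(X,Z^\top)=\beta(X)Z^\perp$ for all $X\in TM$ (it exists because $\langle B(X,Z^\top),Z^\perp\rangle=0$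 and $Z^\perp$ is lightlike). *)

(* Defs.v *)
From HB Require Import structures.
From mathcomp Require Import all_boot all_order all_algebra.
From mathcomp Require Import all_classical all_reals all_analysis.
Set Implicit Arguments.
Unset Strict Implicit.
Unset Printing Implicit Defensive.
Import Order.TTheory GRing.Theory Num.Theory.
Import numFieldNormedType.Exports.
Local Open Scope classical_set_scope.
Local Open Scope ring_scope.

Section Smoothness.
Context {R : realType} {V W : normedModType R}.

(* Meant for open U and finite-dimensional V, where "differentiable with all
   directional derivatives of class C^k" is equivalent to C^(k+1). *)
Fixpoint Ck_on (k : nat) (U : set V) (f : V -> W) : Prop :=
  match k with
  | 0 => forall x, U x -> {for x, continuous f}
  | k'.+1 => (forall x, U x -> differentiable f x) /\
             (forall v : V, Ck_on k' U (fun x => 'D_v f x))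
  end.

Definition smooth_on (U : set V) (f : V -> W) : Prop :=
  forall k : nat, Ck_on k U f.

End Smoothness.

Section Minkowski.
Context {R : realType}.

Definition mink (u v : 'rV[R]_4) : R :=
  \sum_(i < 4 | i != ord_max) u 0 i * v 0 i - u 0 ord_max * v 0 ord_max.

(* The Levi-Civita connection of R^{3,1} is the directional derivative. *)
Definition parallel (Z : 'rV[R]_4 -> 'rV[R]_4) : Prop :=
  forall p, differentiable Z p /\ forall v, 'D_v Z p = 0.

Definition lightlike (v : 'rV[R]_4) : Prop := v != 0 /\ mink v v = 0.

End Minkowski.

Section Surfaces.
Context {R : realType}.
Local Notation R2 := 'rV[R]_2.
Local Notation R4 := 'rV[R]_4.

(* Regular local parametrization: a smooth immersion of an open set of the
   plane which is a homeomorphism onto an open subset of M (the last clause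
   says that phi is open onto M). *)
Definition local_param (M : set R4) (U : set R2) (phi : R2 -> R4) : Prop :=
  [/\ open U, smooth_on U phi,
      (forall q v, U q -> 'D_v phi q = 0 -> v = 0),
      (forall q q', U q -> U q' -> phi q = phi q' -> q = q') &
      (forall V : set R2, open V -> V `<=` U ->
         exists2 O : set R4, open O & phi @` V = M `&` O)].

Definition surface (M : set R4) : Prop :=
  forall p, M p -> exists U phi, local_param M U phi /\ (phi @` U) p.

Definition tangent (M : set R4) (p v : R4) : Prop :=
  exists U phi q w,
    [/\ local_param M U phi, U q, phi q = p & 'D_w phi q = v].

Definition spacelike (M : set R4) : Prop :=
  forall p v, M p -> tangent M p v -> v != 0 -> 0 < mink v v.

(* An orientation is given by the predicate "(u, v) is a positively oriented
   basis of T_p M"; locally it must come from the coordinate frame of some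
   parametrization. Its values on other pairs are irrelevant. *)
Definition orientation (M : set R4) (pos : R4 -> R4 -> R4 -> Prop) : Prop :=
  forall p, M p -> exists U phi,
    [/\ local_param M U phi, (phi @` U) p &
        forall q (w1 w2 : R2), U q ->
          pos (phi q) ('D_w1 phi q) ('D_w2 phi q) <->
          0 < \det (col_mx w1 w2 : 'M[R]_2)].

(* Functions and vector fields on M are total maps on R^4; only their values
   on M matter. *)
Definition smooth_along {E : normedModType R} (M : set R4) (F : R4 -> E) : Prop :=
  forall U phi, local_param M U phi -> smooth_on U (F \o phi).

Definition tangent_field (M : set R4) (X : R4 -> R4) : Prop :=
  smooth_along M X /\ forall p, M p -> tangent M p (X p).

(* Derivative at p of a map F smooth along M, in the tangent direction v,
   computed in any parametrization around p. For R^4-valued F this is the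
   ambient Levi-Civita connection along M. *)
Definition deriv_along {E : normedModType R} (M : set R4) (F : R4 -> E)
    (p v : R4) : E :=
  xget 0 [set d | exists U phi q w,
    [/\ local_param M U phi, U q, phi q = p, 'D_w phi q = v &
        d = 'D_w (F \o phi) q]].

(* The connection nabla is Levi-Civita for the metric induced on M. Torsion
   freeness is nabla_X Y - nabla_Y X = [X, Y], where [X, Y] is the derivation
   f |-> X (Y f) - Y (X f). *)
Definition levi_civita (M : set R4)
    (nabla : (R4 -> R4) -> (R4 -> R4) -> R4 -> R4) : Prop :=
  [/\ forall X Y, tangent_field M X -> tangent_field M Y ->
        tangent_field M (nabla X Y),
      forall X X' Y (f : R4 -> R) p,
        tangent_field M X -> tangent_field M X' -> tangent_field M Y ->
        smooth_along M f -> M p ->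
        nabla (fun r => f r *: X r + X' r) Y p =
        f p *: nabla X Y p + nabla X' Y p,
      forall X Y Y' (f : R4 -> R) p,
        tangent_field M X -> tangent_field M Y -> tangent_field M Y' ->
        smooth_along M f -> M p ->
        nabla X (fun r => f r *: Y r + Y' r) p =
        deriv_along M f p (X p) *: Y p + f p *: nabla X Y p + nabla X Y' p,
      forall X Y (f : R4 -> R) p,
        tangent_field M X -> tangent_field M Y -> smooth_along M f -> M p ->
        deriv_along M f p (nabla X Y p) - deriv_along M f p (nabla Y X p) =
        deriv_along M (fun r => deriv_along M f r (Y r)) p (X p) -
        deriv_along M (fun r => deriv_along M f r (X r)) p (Y p) &
      forall X Y V p,
        tangent_field M X -> tangent_field M Y -> tangent_field M V -> M p ->
        deriv_along M (fun r => mink (Y r) (V r)) p (X p) =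
        mink (nabla X Y p) (V p) + mink (Y p) (nabla X V p)].

Definition second_ff (M : set R4)
    (nabla : (R4 -> R4) -> (R4 -> R4) -> R4 -> R4)
    (X Y : R4 -> R4) (p : R4) : R4 :=
  deriv_along M Y p (X p) - nabla X Y p.

(* Z^T and Z^\perp; the tangent part exists and is unique when M is a
   spacelike surface and p is in M. *)
Definition tan_part (M : set R4) (Z : R4 -> R4) (p : R4) : R4 :=
  xget 0 [set t | tangent M p t /\
                  forall v, tangent M p v -> mink (Z p - t) v = 0].

Definition nor_part (M : set R4) (Z : R4 -> R4) (p : R4) : R4 :=
  Z p - tan_part M Z p.

Definition canonical_normal_null_direction (M : set R4) (Z : R4 -> R4) : Prop :=
  forall p, M p -> lightlike (nor_part M Z p).

Definition unit_orthogonal_field (M : set R4) (pos : R4 -> R4 -> R4 -> Prop)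
    (Z W : R4 -> R4) : Prop :=
  tangent_field M W /\
  forall p, M p ->
    [/\ mink (W p) (W p) = 1, mink (tan_part M Z p) (W p) = 0 &
        pos p (tan_part M Z p) (W p)].

Definition a_function (M : set R4)
    (nabla : (R4 -> R4) -> (R4 -> R4) -> R4 -> R4)
    (Z W : R4 -> R4) (p : R4) : R :=
  mink (second_ff M nabla W W p) (nor_part M Z p).

Definition is_beta (M : set R4)
    (nabla : (R4 -> R4) -> (R4 -> R4) -> R4 -> R4)
    (Z : R4 -> R4) (beta : R4 -> R4 -> R) : Prop :=
  forall X p, tangent_field M X -> M p ->
    second_ff M nabla X (tan_part M Z) p = beta p (X p) *: nor_part M Z p.

End Surfaces.

(* Main.v *)
Require Import Defs.
From HB Require Import structures.
From mathcomp Require Import all_boot all_order all_algebra.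
From mathcomp Require Import ring lra.
From mathcomp Require Import all_classical all_reals all_analysis.
Set Implicit Arguments.
Unset Strict Implicit.
Unset Printing Implicit Defensive.
Import Order.TTheory GRing.Theory Num.Theory.
Import numFieldNormedType.Exports.
Local Open Scope classical_set_scope.
Local Open Scope ring_scope.

(** The field [Z] is constant; write [Z = T + N] for its tangent and normal parts.

    Since [N] is null and orthogonal to the unit field [T] and to [W], any vector
    orthogonal to [N], [T] and [W] is a multiple of [N] ([null_normal_line]).
    Differentiating the relations between [T], [W] and [Z], and using [a = 0],
    [beta T = 0] and the symmetry of the second fundamental form (here
    [torsion_free]), one finds that the ambient derivative of [T] vanishes along
    [T] and is a multiple of [N] in every tangent direction ([derive_tan_part]).
    The first fact says that the integral curves of [T] are straight lines along
    which [T] is constant, so that [M] is ruled by them.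

    The second fact makes it possible to parametrize these lines without
    integrating an ordinary differential equation. As [N = Z - T], all derivatives of
    [N] are multiples of [N], hence the direction of [N] is locally a constant
    null vector [n] ([nor_part_direction]), and every tangent vector is orthogonal
    to [n]. Near a point [p], the functions [mink (phi - p) Z] and
    [mink (phi - p) (W p)] are then local coordinates, by the inverse function
    theorem ([inverse_function]): a tangent vector killed by both is a multiple of
    [n], hence null, hence zero because [M] is spacelike. In these coordinates the
    first coordinate field is exactly [T] ([adapted_chart]), and integrating along
    the first coordinate gives [psi (x, y) = psi (0, y) + x T (psi (0, y))]
    ([ruled_chart]). The curve is [alpha y = psi (0, y)].

    The inverse function theorem is proved by contraction, and the smoothness of
    the inverse by Cramer's rule. Tangent vectors and derivatives along [M] are
    defined through arbitrary charts, so their independence of the chart is proved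
    from the differentiability of transition maps ([change_chart]), which rests
    on the same lifting lemma as the inverse function theorem
    ([differentiable_lift]). *)

(** * Directional derivatives *)

Section DifferentialCalculus.
Context {R : realType}.
Implicit Types U V W : normedModType R.

Lemma diff_approx V W (f : V -> W) x e : differentiable f x -> 0 < e ->
  \forall h \near (0 : V), `|f (h + x) - f x - 'd f x h| <= e * `|h|.
Proof.
move=> /diff_locallyP[_ /eqaddoP fx] e0.
by near do rewrite -addrA -opprD; exact: fx.
Unshelve. all: by end_near. Qed.

(** The epsilon form of Frechet differentiability, which avoids the Landau
    notation when a derivative has to be guessed and then verified. *)
Lemma approx_diff V W (f : V -> W) (df : {linear V -> W}) x :
  continuous df ->
  (forall e, 0 < e ->
    \forall h \near (0 : V), `|f (h + x) - f x - df h| <= e * `|h|) ->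
  differentiable f x /\ 'd f x = df :> (V -> W).
Proof.
move=> cdf fx.
have fE : f \o shift x = cst (f x) + df +o_ 0 id.
  apply/eqaddoP => e e0; near=> h.
  by rewrite [X in `|X|](_ : _ = f (h + x) - f x - df h) ?fctE ?opprD ?addrA//;
    near: h; exact: fx.
have dE := diff_unique cdf fE.
by split => //; apply/diff_locallyP; rewrite dE.
Unshelve. all: by end_near. Qed.

Lemma near_eq_differentiable V W (f g : V -> W) x :
  (\forall y \near x, f y = g y) -> differentiable f x -> differentiable g x.
Proof.
move=> fg df; apply: (proj1 (@approx_diff _ _ g ('d f x) x _ _)).
  exact: diff_continuous.
have fg0 : \forall h \near (0 : V), f (h + x) = g (h + x).
  have := fg; rewrite (near_shift 0) /=; apply: filterS => h /=.
  by rewrite subr0.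
move=> e e0; near=> h; rewrite -(nbhs_singleton fg) -(_ : f (h + x) = g (h + x)).
  by near: h; exact: diff_approx.
by near: h.
Unshelve. all: by end_near. Qed.

Lemma derive_combo V W (f : V -> W) x a u v : differentiable f x ->
  'D_(a *: u + v) f x = a *: 'D_u f x + 'D_v f x.
Proof. by move=> df; rewrite !deriveE// linearP. Qed.

Lemma derive_lin2 V W (f : V -> W) x a b u v : differentiable f x ->
  'D_(a *: u + b *: v) f x = a *: 'D_u f x + b *: 'D_v f x.
Proof.
move=> df; rewrite derive_combo//; congr (_ + _).
by rewrite !deriveE// linearZ.
Qed.

Lemma derive_comp U V W (f : U -> V) (g : V -> W) x v :
  differentiable f x -> differentiable g (f x) ->
  'D_v (g \o f) x = 'D_('D_v f x) g (f x).
Proof.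
move=> df dg; rewrite !deriveE//; last exact: differentiable_comp.
by rewrite diff_comp.
Qed.

Lemma derive_coord V n (f : V -> 'rV[R]_n) x v j : differentiable f x ->
  ('D_v f x) 0 j = 'D_v (fun y => f y 0 j) x.
Proof. by move=> df; rewrite derive_mx ?mxE//; exact: diff_derivable. Qed.

Lemma differentiable_coordP V n (f : V -> 'rV[R]_n) x :
  differentiable f x <-> forall j, differentiable (fun y => f y 0 j) x.
Proof.
split=> [df j|df].
  have -> : (fun y => f y 0 j) = (fun u : 'rV[R]_n => u 0 j) \o f by [].
  by apply: differentiable_comp => //; exact: differentiable_coord.
have -> : f = \sum_(j < n) (fun y => f y 0 j *: delta_mx 0 j).
  by apply/funext => y; rewrite fct_sumE -row_sum_delta.
by apply: differentiable_sum => j; exact: differentiableZl.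
Qed.

Lemma derive_row_sum W n (f : 'rV[R]_n -> W) x v : differentiable f x ->
  'D_v f x = \sum_(j < n) v 0 j *: 'D_(delta_mx 0 j) f x.
Proof.
move=> df; rewrite [in LHS](row_sum_delta v) deriveE// linear_sum.
by apply: eq_bigr => j _; rewrite linearZ/= -deriveE.
Qed.

Lemma row2E (v : 'rV[R]_2) :
  v = v 0 0 *: delta_mx 0 0 + v 0 1 *: delta_mx 0 1.
Proof.
rewrite [LHS]row_sum_delta 2!big_ord_recl big_ord0 addr0.
by have -> : lift ord0 ord0 = 1 :> 'I_2 by exact/val_inj.
Qed.

Lemma derive_row2 W (f : 'rV[R]_2 -> W) x v :
  differentiable f x ->
  'D_v f x = v 0 0 *: 'D_(delta_mx 0 0) f x + v 0 1 *: 'D_(delta_mx 0 1) f x.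
Proof. by move=> df; rewrite [in LHS](row2E v) (derive_lin2 _ _ _ _ df). Qed.

End DifferentialCalculus.

(** * Closure properties of functions of class C^k *)

Section SmoothCalculus.
Context {R : realType}.
Implicit Types V W : normedModType R.

(** Values of a derivative at a point of an open set only depend on the germ of
    the function there; this lets every closure property below be proved by
    rewriting the derivative on the open set alone. *)
Lemma Ck_on_ext k V W (U : set V) (f g : V -> W) : open U ->
  (forall x, U x -> f x = g x) -> Ck_on k U f -> Ck_on k U g.
Proof.
elim: k f g => [|k IH] f g oU fg /=.
  move=> fc x Ux; apply: cvg_trans (_ : f @ x --> g x); last first.
    by rewrite -fg//; exact: fc.
  apply: near_eq_cvg; have : nbhs x U by exact: open_nbhs_nbhs.
  exact: filterS.
have nfg x : U x -> \forall y \near x, f y = g y.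
  by move=> Ux; have : nbhs x U by [exact: open_nbhs_nbhs]; exact: filterS.
move=> [df Df]; split=> [x Ux|v].
  by apply: near_eq_differentiable (df x Ux); exact: nfg.
apply: IH (Df v) => // x Ux; apply: near_eq_derive; exact: nfg.
Qed.

Lemma Ck_on_sub k V W (U U' : set V) (f : V -> W) : U' `<=` U ->
  Ck_on k U f -> Ck_on k U' f.
Proof.
elim: k f => [|k IH] f UU' /=; first by move=> fc x /UU'; exact: fc.
by move=> [df Df]; split=> [x /UU' /df//|v]; exact: IH.
Qed.

Lemma Ck_onW k V W (U : set V) (f : V -> W) : Ck_on k.+1 U f -> Ck_on k U f.
Proof.
elim: k f => [|k IH] f.
  by move=> [df _] x Ux; apply: differentiable_continuous; exact: df.
by move=> [df Df]; split=> // v; exact: IH.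
Qed.

Lemma Ck_on_derive k V W (U : set V) (f : V -> W) v :
  Ck_on k.+1 U f -> Ck_on k U (fun x => 'D_v f x).
Proof. by move=> [_]; exact. Qed.

Lemma Ck_on_cst k V W (U : set V) (c : W) : Ck_on k U (fun=> c).
Proof.
elim: k c => [|k IH] c /=; first by move=> x _; exact: cvg_cst.
split=> [x _|v]; first exact: (differentiable_cst c).
by under eq_fun do rewrite derive_cst; exact: IH.
Qed.

Lemma Ck_onD k V W (U : set V) (f g : V -> W) : open U ->
  Ck_on k U f -> Ck_on k U g -> Ck_on k U (fun x => f x + g x).
Proof.
elim: k f g => [|k IH] f g oU /=.
  by move=> fc gc x Ux; apply: cvgD; [exact: fc|exact: gc].
move=> [df Df] [dg Dg]; split=> [x Ux|v].
  by apply: (@differentiableD _ _ _ f g); [exact: df|exact: dg].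
apply: (@Ck_on_ext _ _ _ _ (fun x => 'D_v f x + 'D_v g x)) => //; last first.
  by apply: IH.
move=> x Ux; rewrite (_ : (fun y => _) = f + g)// deriveD//;
  apply: diff_derivable; [exact: df|exact: dg].
Qed.

(** Leibniz' rule expresses the derivative through products of functions that
    are again of class C^k, which is the induction. *)
Lemma Ck_onM k V (U : set V) (f g : V -> R) : open U ->
  Ck_on k U f -> Ck_on k U g -> Ck_on k U (fun x => f x * g x).
Proof.
elim: k f g => [|k IH] f g oU.
  by move=> fc gc x Ux; apply: cvgM; [exact: fc|exact: gc].
move=> fk gk; have [df Df] := fk; have [dg Dg] := gk; split=> [x Ux|v].
  by apply: (@differentiableM _ _ f g); [exact: df|exact: dg].
apply: (@Ck_on_ext _ _ _ _ (fun x => f x * 'D_v g x + g x * 'D_v f x)) => //.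
  move=> x Ux; rewrite (_ : (fun y => _) = f * g)// deriveM//;
  apply: diff_derivable; [exact: df|exact: dg].
have [f1 g1] := (Ck_onW fk, Ck_onW gk).
by apply: Ck_onD => //; apply: IH => //; [exact: Dg|exact: Df].
Qed.

Lemma Ck_onV k V (U : set V) (f : V -> R) : open U ->
  (forall x, U x -> f x != 0) -> Ck_on k U f -> Ck_on k U (fun x => (f x)^-1).
Proof.
move=> oU f0; elim: k => [|k IH].
  by move=> fc x Ux; apply: cvgV; [exact: f0|exact: fc].
move=> fk; have [df Df] := fk; have Vk := IH (Ck_onW fk); split=> [x Ux|v].
  apply: (@differentiable_comp _ _ _ _ f (fun y => y^-1)); first exact: df.
  by apply: differentiable_Rinv; exact: f0.
apply: (@Ck_on_ext _ _ _ _
  (fun x => -1 * ((f x)^-1 * (f x)^-1 * 'D_v f x))) => //.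
  move=> x Ux; rewrite deriveV//; first by rewrite mulN1r -exprVn expr2 scaleNr.
    exact: f0.
  by apply: diff_derivable; exact: df.
apply: Ck_onM => //; first exact: Ck_on_cst.
by apply: Ck_onM => //; [exact: Ck_onM|exact: Df].
Qed.

Lemma Ck_onN k V (U : set V) (f : V -> R) : open U ->
  Ck_on k U f -> Ck_on k U (fun x => - f x).
Proof.
move=> oU fk; under eq_fun do rewrite -mulN1r.
by apply: Ck_onM => //; exact: Ck_on_cst.
Qed.

Lemma Ck_onB k V (U : set V) (f g : V -> R) : open U ->
  Ck_on k U f -> Ck_on k U g -> Ck_on k U (fun x => f x - g x).
Proof. by move=> oU fk gk; apply: Ck_onD => //; exact: Ck_onN. Qed.

Lemma Ck_on_sum k V (U : set V) (I : Type) (s : seq I) (P : pred I)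
    (f : I -> V -> R) : open U ->
  (forall i, P i -> Ck_on k U (f i)) ->
  Ck_on k U (fun x => \sum_(i <- s | P i) f i x).
Proof.
move=> oU fk; elim: s => [|i s IH].
  by rewrite (_ : (fun x => _) = cst 0); [exact: Ck_on_cst|apply/funext => x; rewrite big_nil].
have [Pi|nPi] := boolP (P i); last first.
  by apply: (Ck_on_ext oU _ IH) => x _; rewrite big_cons (negPf nPi).
apply: (Ck_on_ext oU _ (Ck_onD oU (fk i Pi) IH)) => x _.
by rewrite big_cons Pi.
Qed.

Lemma Ck_on_prod k V (U : set V) (I : Type) (s : seq I) (P : pred I)
    (f : I -> V -> R) : open U ->
  (forall i, P i -> Ck_on k U (f i)) ->
  Ck_on k U (fun x => \prod_(i <- s | P i) f i x).
Proof.
move=> oU fk; elim: s => [|i s IH].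
  by rewrite (_ : (fun x => _) = cst 1); [exact: Ck_on_cst|apply/funext => x; rewrite big_nil].
have [Pi|nPi] := boolP (P i); last first.
  by apply: (Ck_on_ext oU _ IH) => x _; rewrite big_cons (negPf nPi).
apply: (Ck_on_ext oU _ (Ck_onM oU (fk i Pi) IH)) => x _.
by rewrite big_cons Pi.
Qed.

Lemma continuous_at_sum (T : topologicalType) W (I : Type) (s : seq I)
    (f : I -> T -> W) x : (forall i, {for x, continuous (f i)}) ->
  {for x, continuous (fun y => \sum_(i <- s) f i y)}.
Proof.
move=> fc; elim: s => [|i s IH].
  rewrite (_ : (fun y => _) = cst 0); first exact: cvg_cst.
  by apply/funext => y; rewrite big_nil.
rewrite (_ : (fun y => _) = (fun y => f i y + \sum_(j <- s) f j y)).
  by apply: cvgD => //; exact: fc.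
by apply/funext => y; rewrite big_cons.
Qed.

Lemma continuous_coordP V n (f : V -> 'rV[R]_n) x :
  {for x, continuous f} <->
  forall j, {for x, continuous (fun y => f y 0 j)}.
Proof.
split=> [fc j|fc].
  apply: (@continuous_comp _ _ _ f (fun u : 'rV[R]_n => u 0 j)) => //.
  exact: coord_continuous.
have -> : f = (fun y => \sum_(j < n) f y 0 j *: (delta_mx 0 j : 'rV[R]_n)).
  by apply/funext => y; rewrite -row_sum_delta.
apply: continuous_at_sum => j; apply: cvgZr_tmp; exact: fc.
Qed.

(** Reduces smoothness of vector-valued maps to that of real functions, the only
    ones for which products, inverses and compositions are treated. *)
Lemma Ck_on_coordP k V n (U : set V) (f : V -> 'rV[R]_n) : open U ->
  Ck_on k U f <-> forall j, Ck_on k U (fun x => f x 0 j).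
Proof.
move=> oU; elim: k f => [|k IH] f.
  split=> [fc j x Ux|fc x Ux].
    by have /continuous_coordP := fc x Ux; exact.
  by apply/continuous_coordP => j; exact: fc.
split=> [[df Df] j|fk].
  split=> [x Ux|v]; first by have /differentiable_coordP := df x Ux; exact.
  apply: (@Ck_on_ext _ _ _ _ (fun x => ('D_v f x) 0 j)) => //.
    by move=> x Ux; rewrite derive_coord//; exact: df.
  by move: j; apply/(IH (fun x => 'D_v f x)); exact: Df.
have df x : U x -> differentiable f x.
  by move=> Ux; apply/differentiable_coordP => j; have [+ _] := fk j; apply.
split=> // v; apply/IH => j; have [_ /(_ v)] := fk j; apply: Ck_on_ext => //.
by move=> x Ux; rewrite derive_coord//; exact: df.
Qed.

Lemma Ck_on_coord k n (U : set 'rV[R]_n) j :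
  Ck_on k U (fun u : 'rV[R]_n => u 0 j).
Proof.
case: k => [u _|k]; first exact: coord_continuous.
split=> [u _|v]; first exact: differentiable_coord.
rewrite (_ : (fun x => _) = cst (v 0 j)); first exact: Ck_on_cst.
by apply/funext => u; rewrite -(derive_coord _ _ (f := id))// derive_id.
Qed.

Lemma Ck_on_id k (U : set R) : Ck_on k U (fun y : R => y).
Proof.
case: k => [x _|k]; first exact: cvg_id.
split=> [x _|v]; first by [].
rewrite (_ : (fun x => _) = cst v); first exact: Ck_on_cst.
by apply/funext => x; rewrite derive_id.
Qed.

Lemma derive_comp_coord V n (f : V -> 'rV[R]_n) W (g : 'rV[R]_n -> W) x v :
  differentiable f x -> differentiable g (f x) ->
  'D_v (g \o f) x =
  \sum_(j < n) ('D_v f x) 0 j *: 'D_(delta_mx 0 j) g (f x).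
Proof. by move=> df dg; rewrite derive_comp// -derive_row_sum. Qed.

(** The chain rule in coordinates turns the derivative into a sum of products of
    partial derivatives of [g], composed with [f], and of coordinates of the
    derivative of [f]; the induction is therefore over all [g] at once. *)
Lemma Ck_on_comp k V n (U : set V) (U' : set 'rV[R]_n)
    (f : V -> 'rV[R]_n) (g : 'rV[R]_n -> R) : open U ->
  (forall x, U x -> U' (f x)) -> Ck_on k U f -> Ck_on k U' g ->
  Ck_on k U (g \o f).
Proof.
move=> oU UU'; elim: k g => [|k IH] g.
  by move=> fc gc x Ux; apply: continuous_comp; [exact: fc|apply: gc; exact: UU'].
move=> fk gk; have [df Df] := fk; have [dg Dg] := gk; split=> [x Ux|v].
  by apply: differentiable_comp; [exact: df|apply: dg; exact: UU'].
apply: (@Ck_on_ext _ _ _ _ (fun x => \sum_(j < n)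
   ('D_v f x) 0 j * ('D_(delta_mx 0 j) g \o f) x)) => //.
  move=> x Ux; rewrite derive_comp_coord//; first exact: df.
  by apply: dg; exact: UU'.
apply: Ck_on_sum => // j _; apply: Ck_onM => //.
  by have /(Ck_on_coordP _ _ oU) := Df v; exact.
by apply: IH; [exact: Ck_onW|exact: Dg].
Qed.

Lemma Ck_on_det k V n (U : set V) (A : V -> 'M[R]_n) : open U ->
  (forall i j, Ck_on k U (fun x => A x i j)) -> Ck_on k U (fun x => \det (A x)).
Proof.
move=> oU Ak; apply: Ck_on_sum => // s _; apply: Ck_onM => //.
  exact: Ck_on_cst.
by apply: Ck_on_prod => // i _; exact: Ak.
Qed.

(** With [Ck_on_det] this is the smooth half of Cramer's rule, used to
    differentiate a local inverse. *)
Lemma Ck_on_adj k V n (U : set V) (A : V -> 'M[R]_n) i j : open U ->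
  (forall i j, Ck_on k U (fun x => A x i j)) ->
  Ck_on k U (fun x => \adj (A x) i j).
Proof.
move=> oU Ak; apply: (@Ck_on_ext _ _ _ _
  (fun x => (-1) ^+ (j + i) * \det (row' j (col' i (A x))))) => //.
  by move=> x _; rewrite mxE.
apply: Ck_onM => //; first exact: Ck_on_cst.
apply: Ck_on_det => // l m; apply: (Ck_on_ext oU _ (Ak (lift j l) (lift i m))).
by move=> x _; rewrite !mxE.
Qed.

End SmoothCalculus.

(** * Mean value theorem along segments *)

Section MeanValue.
Context {R : realType}.

Lemma segment_dist (V : normedModType R) (x a b : V) (t : R) : 0 <= t <= 1 ->
  `|x - (a + t *: (b - a))| <= Num.max `|x - a| `|x - b|.
Proof.
move=> /andP[t0 t1].
rewrite (_ : _ - _ = (1 - t) *: (x - a) + t *: (x - b)); last first.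
  by rewrite scalerBl scale1r -addrA -scalerN -scalerDr opprB subrKA
    opprD addrA -scalerN opprB.
rewrite (le_trans (ler_normD _ _))// !normrZ !ger0_norm ?subr_ge0//.
have : (1 - t) * `|x - a| <= (1 - t) * Num.max `|x - a| `|x - b|.
  by rewrite ler_wpM2l ?subr_ge0// le_max lexx.
have : t * `|x - b| <= t * Num.max `|x - a| `|x - b|.
  by rewrite ler_wpM2l// le_max lexx orbT.
lra.
Qed.

Lemma mean_value_segment (V : normedModType R) (f : V -> R) (a b : V) :
  (forall t : R, 0 <= t <= 1 -> differentiable f (a + t *: (b - a))) ->
  exists2 t : R, 0 <= t <= 1 & f b - f a = 'D_(b - a) f (a + t *: (b - a)).
Proof.
move=> df; pose l (t : R) := a + t *: (b - a).
have lE : l = cst a + (fun t => t *: (b - a)) by [].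
have dl (t : R) : differentiable l t.
  rewrite lE; apply: differentiableD => //; exact: differentiableZl.
have Dl (t : R) : 'D_1 l t = b - a.
  rewrite lE deriveD//; last first.
    by apply: diff_derivable; exact: differentiableZl.
  rewrite derive_cst add0r deriveE; last exact: differentiableZl.
  by rewrite diffZl// -deriveE// derive_id scale1r.
have dfl (t : R) : 0 <= t <= 1 -> differentiable (f \o l) t.
  by move=> t01; apply: differentiable_comp => //; exact: df.
have [||t t01] := @MVT_segment R (f \o l) (fun t => 'D_(b - a) f (l t)) 0 1 ler01.
- move=> t; rewrite in_itv/= => /andP[t0 t1].
  have t01 : 0 <= t <= 1 by rewrite !ltW.
  apply: DeriveDef; first by apply: diff_derivable; exact: dfl.
  by rewrite derive_comp ?Dl//; exact: df.
- apply: continuous_in_subspaceT => t /[!inE]/=; rewrite in_itv/= => t01.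
  by apply: differentiable_continuous; exact: dfl.
rewrite subr0 mulr1 /l /= scale1r scale0r addr0 subrKC => fE.
by exists t => //; move: t01; rewrite in_itv.
Qed.

Lemma derive_cst_on (V W : normedModType R) (U : set V) (f : V -> W) c q v :
  open U -> U q -> (forall x, U x -> f x = c) -> 'D_v f q = 0.
Proof.
move=> oU Uq fc; rewrite (@near_eq_derive _ _ _ _ (cst c)) ?derive_cst//.
by apply: filterS (open_nbhs_nbhs (conj oU Uq)).
Qed.

Lemma derive0_eq (V : normedModType R) n (f : V -> 'rV[R]_n) (a b : V) :
  (forall t : R, 0 <= t <= 1 -> differentiable f (a + t *: (b - a)) /\
     'D_(b - a) f (a + t *: (b - a)) = 0) -> f b = f a.
Proof.
move=> fD; apply/rowP => j; apply/eqP; rewrite -subr_eq0; apply/eqP.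
have [t t01|t t01 ->] := @mean_value_segment _ (fun y => f y 0 j) a b.
  by have [/differentiable_coordP] := fD t t01; exact.
by have [df D0] := fD t t01; rewrite -derive_coord// D0 mxE.
Qed.

Lemma ball_segment (V : normedModType R) (x a b : V) r t :
  ball x r a -> ball x r b -> 0 <= t <= 1 -> ball x r (a + t *: (b - a)).
Proof.
rewrite -ball_normE/= => ra rb t01.
by rewrite (le_lt_trans (segment_dist _ _ _ t01))// gt_max ra.
Qed.

End MeanValue.

HB.instance Definition _ (R : realType) m n := Complete.on 'M[R]_(m, n).

(** * Lifting differentiability and the inverse function theorem *)

Section InverseFunction.
Context {R : realType}.

Lemma coord_le_norm n (u : 'rV[R]_n) j : `|u 0 j| <= `|u|.
Proof.
by rewrite [leRHS]/Num.Def.normr/= mx_normrE; exact: (le_bigmax _ _ (0, j)).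
Qed.

Lemma norm_le_coord n (u : 'rV[R]_n) c : 0 <= c ->
  (forall j, `|u 0 j| <= c) -> `|u| <= c.
Proof.
move=> c0 uc; rewrite [leLHS]/Num.Def.normr/= mx_normrE.
by apply: bigmax_le => // -[i j] _ /=; rewrite ord1.
Qed.

Lemma linear_continuous_rV n (W : normedModType R) (f : {linear 'rV[R]_n -> W}) :
  continuous f.
Proof.
have fE u : f u = \sum_(j < n) u 0 j *: f (delta_mx 0 j).
  rewrite [in LHS](row_sum_delta u) linear_sum.
  by apply: eq_bigr => j _; rewrite linearZ.
move=> u; rewrite (funext fE); apply: continuous_at_sum => j.
apply: (@cvgZr_tmp _ _ _ (nbhs u)); exact: (@coord_continuous _ _ _ 0 j u).
Qed.

Lemma differentiable_mulmxr (V : normedModType R) n m (f : V -> 'rV[R]_n)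
    (A : 'M[R]_(n, m)) x : differentiable f x ->
  differentiable (fun y => f y *m A) x.
Proof.
move=> df; apply: (@differentiable_comp _ _ _ _ f (mulmxr A)) => //.
exact/linear_differentiable/linear_continuous_rV.
Qed.

Lemma derive_mulmxr (V : normedModType R) n m (f : V -> 'rV[R]_n)
    (A : 'M[R]_(n, m)) x v : differentiable f x ->
  'D_v (fun y => f y *m A) x = 'D_v f x *m A.
Proof.
have cA : continuous (mulmxr A : 'rV[R]_n -> 'rV[R]_m).
  exact: linear_continuous_rV.
move=> df; rewrite (@derive_comp _ _ _ _ f (mulmxr A))//; last first.
  exact: linear_differentiable.
rewrite deriveE; last exact: linear_differentiable.
by rewrite diff_lin.
Qed.

Lemma row_free_jacobian n m (f : 'rV[R]_n -> 'rV[R]_m) q :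
  differentiable f q -> (forall v, 'D_v f q = 0 -> v = 0) ->
  row_free (jacobian f q).
Proof.
by move=> df f0; apply: inj_row_free => v; rewrite -deriveEjacobian//; exact: f0.
Qed.

(** If the derivative of [f] at [t s] is the identity, then
    [f (t (s + h)) - f (t s) = k + o(k)] with [k = t (s + h) - t s], while the
    left-hand side is the linear term of [f \o t] up to [o(h)]. Continuity of
    [t] makes [k] small, so [k = O(h)] and the two errors combine into
    [o(h)]. *)
Lemma differentiable_lift_id (V : normedModType R) n
    (f : 'rV[R]_n -> 'rV[R]_n) (t : V -> 'rV[R]_n) s :
  differentiable f (t s) -> (forall v, 'D_v f (t s) = v) ->
  {for s, continuous t} -> differentiable (f \o t) s -> differentiable t s.
Proof.
move=> df dfid ct dft; set df' := 'd (f \o t) s.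
have cdf' : continuous df' by exact: diff_continuous.
have [C C0 leC] := linear_lipschitz cdf'.
apply: (proj1 (approx_diff cdf' _)) => e e0.
pose e1 := e / 2; have e10 : 0 < e1 by rewrite divr_gt0.
(* [e2 <= 1 / 2] gives [k = O(h)]; the second bound absorbs [e2 * |k|] into half
   of the allowed error. *)
pose e2 := Num.min (1 / 2) (e / 2 / (2 * (C + e1))).
have Ce0 : 0 < 2 * (C + e1) by rewrite mulr_gt0// addr_gt0.
have e20 : 0 < e2 by rewrite lt_min !divr_gt0.
have e2h : e2 <= 1 / 2 by rewrite ge_min lexx.
have e2C : e2 * (2 * (C + e1)) <= e / 2.
  by rewrite -ler_pdivlMr// ge_min lexx orbT.
have H1 : \forall h \near (0 : V), `|f (t (h + s)) - f (t s) - df' h| <= e1 * `|h|.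
  exact: (diff_approx dft).
have ct0 : (fun h => t (h + s) - t s) h @[h --> (0 : V)] --> (0 : 'rV[R]_n).
  rewrite -(subrr (t s)); apply: cvgB; last exact: cvg_cst.
  apply: (@cvg_comp _ _ _ (fun h => h + s) t _ (nbhs s)) => //.
  rewrite -[in nbhs s](add0r s).
  by apply: cvgD; [exact: cvg_id|exact: cvg_cst].
have H2 := ct0 _ (diff_approx df e20).
near=> h.
have h1 : `|f (t (h + s)) - f (t s) - df' h| <= e1 * `|h| by near: h.
have : `|f ((t (h + s) - t s) + t s) - f (t s) - 'd f (t s) (t (h + s) - t s)|
   <= e2 * `|t (h + s) - t s| by near: h.
rewrite subrK -deriveE// dfid.
set k := t (h + s) - t s => h2.
have {}h1 : `|k - df' h| <= e2 * `|k| + e1 * `|h|.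
  rewrite (_ : k - df' h = (f (t (h + s)) - f (t s) - df' h) -
    (f (t (h + s)) - f (t s) - k)); last by rewrite opprB [RHS]addrC subrKA.
  by rewrite (le_trans (ler_normB _ _))// addrC lerD.
have kC : `|k| <= 2 * (C + e1) * `|h|.
  have kk : `|k| <= `|k - df' h| + C * `|h|.
    by rewrite -[in leLHS](subrK (df' h) k) (le_trans (ler_normD _ _))// lerD.
  have ek : e2 * `|k| <= 1 / 2 * `|k| by rewrite ler_wpM2r.
  lra.
have : e2 * `|k| <= e / 2 * `|h|.
  by rewrite (le_trans (ler_wpM2l (ltW e20) kC))// mulrA ler_wpM2r.
rewrite /e1 in h1; lra.
Unshelve. all: by end_near. Qed.

(** An immersion becomes a map with identity derivative after composition with a
    left inverse of its Jacobian. This serves twice: for transition maps between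
    charts, and for local inverses. *)
Lemma differentiable_lift (V : normedModType R) n m
    (f : 'rV[R]_n -> 'rV[R]_m) (t : V -> 'rV[R]_n) s :
  differentiable f (t s) -> (forall v, 'D_v f (t s) = 0 -> v = 0) ->
  {for s, continuous t} -> differentiable (f \o t) s -> differentiable t s.
Proof.
move=> df f0 ct dft; have fr := row_free_jacobian df f0.
pose P := pinvmx (jacobian f (t s)).
apply: (@differentiable_lift_id _ _ (fun q => f q *m P)) => //.
- exact: differentiable_mulmxr.
- move=> v; rewrite derive_mulmxr// deriveEjacobian// -mulmxA mulmxVp//.
  by rewrite mulmx1.
- exact: (differentiable_mulmxr _ dft).
Qed.

(** The derivative of the simplified Newton step [K] vanishes at [q0], hence its
    partial derivatives are small nearby by continuity, and the mean value theorem
    makes [K] a contraction of ratio 1/2 on a small ball. *)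
Lemma contraction_estimate n (U : set 'rV[R]_n) (F : 'rV[R]_n -> 'rV[R]_n) q0
    (K := fun q => q - F q *m invmx (jacobian F q0)) :
  open U -> U q0 -> Ck_on 1 U F -> jacobian F q0 \in unitmx ->
  exists2 rho : R, 0 < rho & closed_ball q0 rho `<=` U /\
    forall a b, closed_ball q0 rho a -> closed_ball q0 rho b ->
      `|K a - K b| <= 1 / 2 * `|a - b|.
Proof.
move=> oU Uq0 F1 unitJ; set P := invmx _ in K *.
have dF q : U q -> differentiable F q by case: F1 => + _; apply.
have dK q : U q -> differentiable K q.
  move=> Uq; apply: (@differentiableB _ _ _ id (fun q => F q *m P)) => //.
  by apply: differentiable_mulmxr; exact: dF.
have DK v : 'D_v K q0 = 0.
  rewrite deriveB; last first.
  - by apply: diff_derivable; apply: differentiable_mulmxr; exact: dF.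
  - by apply: diff_derivable.
  rewrite derive_id derive_mulmxr; last exact: dF.
  by rewrite deriveEjacobian ?mulmxK ?subrr//; exact: dF.
have K1 j : Ck_on 1 U (fun q => K q 0 j).
  apply: (@Ck_on_ext R 1 'rV[R]_n R U (fun q => q 0 j - \sum_l F q 0 l * P l j)) => //.
    by move=> q _; rewrite !mxE.
  have Fc l : Ck_on 1 U (fun q => F q 0 l) by move: l; exact/Ck_on_coordP.
  apply: Ck_onB => //; last first.
    by apply: Ck_on_sum => // l _; apply: Ck_onM => //; exact: Ck_on_cst.
  exact: Ck_on_coord.
pose eps : R := (2 * n.+1%:R)^-1.
have eps0 : 0 < eps by rewrite invr_gt0 mulr_gt0.
have nearK : \forall q \near q0, U q /\ forall i j,
    `|'D_(delta_mx 0 i) (fun q => K q 0 j) q| <= eps.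
  apply: filterI; first exact: open_nbhs_nbhs.
  suff : forall i j, \forall q \near q0,
      `|'D_(delta_mx 0 i) (fun q => K q 0 j) q| <= eps.
    move=> H; exact: (filter_forall (nbhs_filter q0)
      (fun i => filter_forall (nbhs_filter q0) (H i))).
  move=> i j.
  set d := 'D_(delta_mx 0 i) (fun q => K q 0 j).
  have d0 : d q0 = 0.
    by have := derive_coord (delta_mx 0 i) j (dK q0 Uq0); rewrite DK mxE => /esym.
  have : d @ q0 --> d q0.
    by have [_ /(_ (delta_mx 0 i)) /(_ q0 Uq0)] := K1 j.
  by rewrite d0 => /cvgr0Pnorm_le; exact.
have [rho ballU] := (nbhs_closedballP _ _).1 nearK.
exists rho%:num => //; split=> [q /ballU[]//|a b qa qb].
apply: norm_le_coord => [|j]; first by rewrite mulr_ge0.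
have seg t : 0 <= t <= 1 -> closed_ball q0 rho%:num (b + t *: (a - b)).
  move: qa qb; rewrite closed_ballE// /closed_ball_/= => qa qb t01.
  by rewrite (le_trans (segment_dist _ _ _ t01))// ge_max qa qb.
have dKj q j' : U q -> differentiable (fun q => K q 0 j') q.
  by move=> Uq; have /differentiable_coordP := dK q Uq; exact.
have [t t01] := @mean_value_segment _ _ (fun q => K q 0 j) b a
  (fun t t01 => dKj _ _ (ballU _ (seg t t01)).1).
set c := b + _ => Kab; have [Uc Kc] := ballU _ (seg t t01).
rewrite !mxE -/K in Kab *; rewrite {}Kab derive_row_sum//; last exact: dKj.
rewrite (le_trans (ler_norm_sum _ _ _))//.
apply: (@le_trans _ _ (\sum_(i < n) `|a - b| * eps)).
  by apply: ler_sum => i _; rewrite normrM ler_pM// coord_le_norm.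
rewrite sumr_const card_ord -mulrnAr mulrC ler_wpM2r//.
rewrite -mulr_natr /eps ler_pdivrMl ?mulr_gt0// mul1r mulrAC divff// mul1r.
by rewrite ler_nat.
Qed.

End InverseFunction.

Section InverseFunctionTheorem.
Context {R : realType} {n : nat}.
Implicit Types (U : set 'rV[R]_n) (F G : 'rV[R]_n -> 'rV[R]_n).

(** Solving [F q = y] amounts to finding a fixed point of the simplified Newton
    map [q |-> K q + y J^-1], where [J] is the Jacobian at [q0], a contraction of
    a closed ball when [y] is close to [F q0]. The contraction estimate also
    bounds distances by those of the images, so that [F] is injective on the ball
    and the inverse is Lipschitz. *)
Lemma local_inverse U F q0 : open U -> U q0 -> Ck_on 1 U F ->
  jacobian F q0 \in unitmx ->
  exists (B : set 'rV[R]_n) (r C : R) G,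
    [/\ 0 < r, [/\ open B, B q0 & B `<=` U],
        forall y, ball (F q0) r y -> B (G y) /\ F (G y) = y,
        0 < C &
        forall a b, B a -> B b -> `|a - b| <= C * `|F a - F b|].
Proof.
move=> oU Uq0 F1 unitJ.
have [rho rho0 [ballU Klip]] := contraction_estimate oU Uq0 F1 unitJ.
set P := invmx _ in Klip.
have cP : continuous (mulmxr P : 'rV[R]_n -> 'rV[R]_n).
  exact: linear_continuous_rV.
have [C C0 CP] := linear_lipschitz cP.
have distP a b : closed_ball q0 rho a -> closed_ball q0 rho b ->
    `|a - b| <= 2 * `|(F a - F b) *m P|.
  move=> qa qb; have := Klip _ _ qa qb.
  set k := (X in `|X|) => kab.
  have : `|a - b| <= `|k| + `|(F a - F b) *m P|.
    rewrite (_ : a - b = k + (F a - F b) *m P) ?ler_normD//.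
    by rewrite /k mulmxBl; apply/rowP => j; rewrite !mxE; ring.
  lra.
pose B := ball q0 rho; pose r := rho / (2 * C).
have r0 : 0 < r by rewrite divr_gt0// mulr_gt0.
have Bsub a : B a -> closed_ball q0 rho a by exact: subset_closed_ball.
have Gex y : ball (F q0) r y -> exists q, B q /\ F q = y.
  rewrite -ball_normE/= => yr.
  have yP : `|(F q0 - y) *m P| < rho / 2.
    rewrite (le_lt_trans (CP _))//.
    by rewrite (_ : rho / 2 = C * r) ?ltr_pM2l// /r; field; rewrite gt_eqF.
  pose f q := q - F q *m P + y *m P.
  have q0f q : closed_ball q0 rho q ->
      `|q0 - f q| <= 1 / 2 * `|q0 - q| + `|(F q0 - y) *m P|.
    move=> Bq; have q0B : closed_ball q0 rho q0 by apply: Bsub; exact: ballxx.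
    rewrite (_ : q0 - f q = (q0 - F q0 *m P - (q - F q *m P)) +
      (F q0 - y) *m P); last first.
      by rewrite /f mulmxBl; apply/rowP => j; rewrite !mxE; ring.
    by rewrite (le_trans (ler_normD _ _))// lerD2r; exact: Klip.
  have fB : {homo f : q / closed_ball q0 rho q >-> closed_ball q0 rho q}.
    move=> q /[dup] /q0f; rewrite closed_ballE// /closed_ball_/=.
    move=> fq qr; lra.
  have [|||p Bp fp] := @banach_fixed_point _ _ (closed_ball q0 rho) (mkfun_fun fB).
  - have h0 : 0 <= 1 / 2 :> R by [].
    exists (NngNum h0); split => /=; first lra.
    move=> [a b] /= [Ba Bb]; rewrite /mkfun /f.
    rewrite (_ : _ - _ = (a - F a *m P) - (b - F b *m P)); first exact: Klip.
    by apply/rowP => j; rewrite !mxE; ring.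
  - exact: closed_ball_closed.
  - by exists q0; apply: Bsub; exact: ballxx.
  rewrite /= /mkfun in fp; exists p; split.
    rewrite /B -ball_normE/=; have := q0f _ Bp; rewrite -fp => H.
    have : `|q0 - p| <= rho by move: Bp; rewrite closed_ballE.
    lra.
  apply: (can_inj (mulmxK (_ : P \in unitmx))); first by rewrite unitmx_inv.
  move/eqP: fp; rewrite /f -addrA -[X in X == _]addr0 (inj_eq (addrI p)).
  by rewrite eq_sym addrC subr_eq0 => /eqP.
exists B, r, (2 * C), (fun y => xget q0 [set q | B q /\ F q = y]).
split=> //; [split=> //| | |].
- exact: ball_open.
- exact: ballxx.
- by move=> q /Bsub/ballU.
- by move=> y /Gex yq; have /= := xgetPex q0 yq.
- by rewrite mulr_gt0.
move=> a b /Bsub Ba /Bsub Bb; rewrite (le_trans (distP _ _ Ba Bb))// -mulrA.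
by rewrite ler_wpM2l//; exact: CP.
Qed.

(** A continuous local inverse is differentiable by [differentiable_lift], with
    derivative the inverse Jacobian of [F] composed with [G]; by Cramer's rule [G]
    is of class C^(k+1) as soon as it is of class C^k. *)
Lemma smooth_local_inverse (U Y : set 'rV[R]_n) F G : open U -> open Y ->
  smooth_on U F -> (forall q v, U q -> 'D_v F q = 0 -> v = 0) ->
  (forall y, Y y -> U (G y) /\ F (G y) = y) ->
  (forall y, Y y -> {for y, continuous G}) -> smooth_on Y G.
Proof.
move=> oU oY sF F0 GP cG.
have dF q : U q -> differentiable F q by case: (sF 1%N) => + _; apply.
have FGid y : Y y -> \forall z \near y, z = (F \o G) z.
  move=> Yy; have : nbhs y Y by exact: open_nbhs_nbhs.
  by apply: filterS => z /GP[_] /=.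
have dG y : Y y -> differentiable G y.
  move=> Yy; have [UG _] := GP y Yy.
  apply: (@differentiable_lift _ _ _ _ F) => //.
  - exact: dF.
  - by move=> v; exact: F0.
  - exact: cG.
  - exact: (near_eq_differentiable (FGid y Yy)).
have DG v y : Y y -> 'D_v G y = v *m invmx (jacobian F (G y)).
  move=> Yy; have [UG _] := GP y Yy.
  have : 'D_v (F \o G) y = v.
    by rewrite -(near_eq_derive v (FGid y Yy)) derive_id.
  rewrite derive_comp; [|exact: dG|exact: dF].
  rewrite deriveEjacobian; last exact: dF.
  move=> JE; rewrite -[in RHS]JE mulmxK// -row_free_unit.
  by apply: row_free_jacobian; [exact: dF|move=> w; exact: F0].
elim=> [|k IH]; first exact: cG.
split=> [y Yy|v]; first exact: dG.
pose A y := jacobian F (G y).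
have Ak i j : Ck_on k Y (fun y => A y i j).
  apply: (@Ck_on_ext _ _ _ _ _
    ((fun q => ('D_(delta_mx 0 i) F q) 0 j) \o G)) => //.
    move=> y Yy /=; rewrite deriveE ?mxE//; apply: dF; exact: (GP y Yy).1.
  apply: (@Ck_on_comp _ _ _ _ _ U) => //; first by move=> y /GP[].
  by have /(Ck_on_coordP _ _ oU) := Ck_on_derive (delta_mx 0 i) (sF k.+1); exact.
apply/Ck_on_coordP => // j; apply: (@Ck_on_ext _ _ _ _ _
  (fun y => \sum_i v 0 i * ((\det (A y))^-1 * \adj (A y) i j))) => //.
  move=> y Yy; rewrite DG// mxE; apply: eq_bigr => i _.
  rewrite /invmx ifT ?mxE// -row_free_unit; have [UG _] := GP y Yy.
  by apply: row_free_jacobian; [exact: dF|move=> w; exact: F0].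
apply: Ck_on_sum => // i _; apply: Ck_onM => //; first exact: Ck_on_cst.
apply: Ck_onM => //; last exact: Ck_on_adj.
apply: Ck_onV => //; last exact: Ck_on_det.
move=> y Yy; have [UG _] := GP y Yy; rewrite -unitfE -unitmxE -row_free_unit.
by apply: row_free_jacobian; [exact: dF|move=> w; exact: F0].
Qed.

Theorem inverse_function U F q0 : open U -> U q0 -> smooth_on U F ->
  (forall q v, U q -> 'D_v F q = 0 -> v = 0) ->
  exists (B : set 'rV[R]_n) (r : R) G,
    [/\ 0 < r, [/\ open B, B q0 & B `<=` U],
        forall a b, B a -> B b -> F a = F b -> a = b,
        forall y, ball (F q0) r y -> B (G y) /\ F (G y) = y &
        smooth_on (ball (F q0) r) G].
Proof.
move=> oU Uq0 sF F0.
have unitJ : jacobian F q0 \in unitmx.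
  rewrite -row_free_unit; apply: row_free_jacobian; last by move=> v; exact: F0.
  by case: (sF 1%N) => + _; apply.
have [B [r [C [G [r0 [oB Bq0 BU] GP C0 CP]]]]] :=
  local_inverse oU Uq0 (sF 1%N) unitJ.
exists B, r, G; split=> //.
  move=> a b Ba Bb Fab; apply/eqP; rewrite -subr_eq0 -normr_le0.
  by rewrite (le_trans (CP _ _ Ba Bb))// Fab subrr normr0 mulr0.
apply: (@smooth_local_inverse U _ F) => //.
- exact: ball_open.
- by move=> y /GP[/BU].
move=> y yr; apply/(@cvgrPdist_lt _ _ _ (nbhs y)) => e e0.
have yB : nbhs y (ball (F q0) r `&` ball y (C^-1 * e)).
  apply: filterI; first by apply: open_nbhs_nbhs; split=> //; exact: ball_open.
  by apply: nbhsx_ballx; rewrite mulr_gt0 ?invr_gt0.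
apply: (filterS _ yB) => z [zr]; rewrite -ball_normE/= => yz.
have [[BGy FGy] [BGz FGz]] := (GP y yr, GP z zr).
by rewrite (le_lt_trans (CP _ _ BGy BGz))// FGy FGz -ltr_pdivlMl.
Qed.

End InverseFunctionTheorem.

(** * The Minkowski product *)

Section MinkowskiAlgebra.
Context {R : realType}.
Implicit Types u v w n x T W : 'rV[R]_4.

Lemma mink_sum u v :
  mink u v = \sum_i (-1) ^+ (i == ord_max) * (u 0 i * v 0 i).
Proof.
rewrite /mink [RHS](bigD1 ord_max)//= expr1 mulN1r addrC; congr (_ - _).
by apply: eq_bigr => i /negPf ->; rewrite expr0 mul1r.
Qed.

Lemma minkC u v : mink u v = mink v u.
Proof. by rewrite !mink_sum; apply: eq_bigr => i _; rewrite [u _ _ * _]mulrC. Qed.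

Lemma minkDl u v w : mink (u + v) w = mink u w + mink v w.
Proof.
by rewrite !mink_sum -big_split; apply: eq_bigr => i _ /=; rewrite !mxE; ring.
Qed.

Lemma minkZl a u w : mink (a *: u) w = a * mink u w.
Proof.
by rewrite !mink_sum big_distrr; apply: eq_bigr => i _ /=; rewrite !mxE; ring.
Qed.

Lemma minkNl u w : mink (- u) w = - mink u w.
Proof. by rewrite -scaleN1r minkZl mulN1r. Qed.

Lemma minkBl u v w : mink (u - v) w = mink u w - mink v w.
Proof. by rewrite minkDl minkNl. Qed.

Lemma mink0l w : mink 0 w = 0.
Proof. by rewrite -(scale0r (0 : 'rV[R]_4)) minkZl mul0r. Qed.

Lemma minkDr u v w : mink w (u + v) = mink w u + mink w v.
Proof. by rewrite minkC minkDl !(minkC w). Qed.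

Lemma minkZr a u w : mink w (a *: u) = a * mink w u.
Proof. by rewrite minkC minkZl minkC. Qed.

Lemma minkNr u w : mink w (- u) = - mink w u.
Proof. by rewrite minkC minkNl minkC. Qed.

Lemma minkBr u v w : mink w (u - v) = mink w u - mink w v.
Proof. by rewrite minkDr minkNr. Qed.

Lemma mink0r w : mink w 0 = 0.
Proof. by rewrite minkC mink0l. Qed.

Definition minkE :=
  (minkDl, minkBl, minkZl, minkNl, mink0l, minkDr, minkBr, minkZr, minkNr, mink0r).

Lemma parallel_cst (Z : 'rV[R]_4 -> 'rV[R]_4) p : parallel Z -> Z p = Z 0.
Proof. by move=> pZ; apply: derive0_eq => t _; have [dZ DZ] := pZ (0 + t *: (p - 0)). Qed.

(** The product is definite on the hyperplane where the last coordinate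
    vanishes. The last coordinate can thus serve to normalize lightlike vectors. *)
Lemma lightlike_time_neq0 v : lightlike v -> v 0 ord_max != 0.
Proof.
move=> [v0 vv]; apply: contra v0 => /eqP v40; apply/eqP/rowP => j.
rewrite mxE; have [-> //|j4] := eqVneq j ord_max.
move: vv; rewrite /mink v40 mulr0 subr0 => /eqP.
rewrite psumr_eq0; last by move=> i _; rewrite -expr2 sqr_ge0.
by move=> /allP/(_ j (mem_index_enum j)); rewrite j4/= mulf_eq0 orbb => /eqP.
Qed.

(** In a space of dimension 4 the vectors orthogonal to an orthonormal pair
    [T], [W] form a plane, in which the orthogonal of a null vector is the line it
    spans. Concretely, [n] is orthogonal to [n], [x], [T] and [W], so by
    nondegeneracy these four vectors are linearly dependent, and pairing a
    dependency with [T] and [W] removes these two. *)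
Lemma null_normal_line n T W x : n != 0 -> mink n n = 0 ->
  mink n T = 0 -> mink n W = 0 ->
  mink T T = 1 -> mink W W = 1 -> mink T W = 0 ->
  mink x n = 0 -> mink x T = 0 -> mink x W = 0 -> exists c, x = c *: n.
Proof.
move=> n0 nn nT nW TT WW TW xn xT xW.
pose rows i : 'rV[R]_4 := nth 0 [:: n; x; T; W] i.
pose A : 'M[R]_4 := \matrix_(i < 4) rows i.
have rowsn (i : 'I_4) : mink (rows i) n = 0.
  by rewrite /rows; case: i => [[|[|[|[|//]]]]] i4 //=; rewrite minkC.
have detA : \det A == 0.
  apply: contraT => detA; have uA : A \in unitmx by rewrite unitmxE unitfE.
  pose c : 'cV[R]_4 := \col_j ((-1) ^+ (j == ord_max) * n 0 j).
  have Ac : A *m c = 0.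
    apply/colP => i; rewrite !mxE -[RHS](rowsn i) mink_sum.
    by apply: eq_bigr => j _; rewrite !mxE; ring.
  case/negP: n0; apply/eqP/rowP => j; have /colP/(_ j) : c = 0.
    by rewrite -(mulKmx uA c) Ac mulmx0.
  by rewrite !mxE => /eqP; rewrite mulf_eq0 signr_eq0/= => /eqP.
have [v v0 vA] := det0P detA.
have vE : v 0 0 *: n + (v 0 1 *: x + (v 0 2%:R *: T + v 0 3%:R *: W)) = 0.
  rewrite -[RHS]vA mulmx_sum_row !big_ord_recl big_ord0 addr0 !rowK /rows /=.
  by do ?congr (_ + _); congr (v 0 _ *: _); apply/val_inj.
have pair y : v 0 0 * mink n y + (v 0 1 * mink x y +
    (v 0 2%:R * mink T y + v 0 3%:R * mink W y)) = 0.
  by rewrite -!minkZl -!minkDl vE mink0l.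
have v2 : v 0 2%:R = 0.
  by have := pair T; rewrite nT xT TT (minkC W) TW; lra.
have v3 : v 0 3%:R = 0.
  by have := pair W; rewrite nW xW TW WW; lra.
have v1 : v 0 1 != 0.
  apply: contra v0 => /eqP v1; move: vE; rewrite v1 v2 v3 !scale0r !addr0.
  move=> /eqP; rewrite scaler_eq0 (negPf n0) orbF => /eqP v00.
  apply/eqP/rowP => -[[|[|[|[|//]]]] i4]; rewrite mxE.
  - by rewrite -v00; congr (v 0 _); apply/val_inj.
  - by rewrite -v1; congr (v 0 _); apply/val_inj.
  - by rewrite -v2; congr (v 0 _); apply/val_inj.
  - by rewrite -v3; congr (v 0 _); apply/val_inj.
exists (- (v 0 0 / v 0 1)); move: vE; rewrite v2 v3 !scale0r !addr0 => /eqP.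
rewrite addrC addr_eq0 => /eqP xE.
by rewrite -[LHS](scalerK v1) xE scalerN scalerA -scaleNr mulrC.
Qed.

End MinkowskiAlgebra.

Section MinkowskiCalculus.
Context {R : realType} {V : normedModType R}.
Implicit Types f g : V -> 'rV[R]_4.

Lemma Ck_on_mink k (U : set V) f g : open U -> Ck_on k U f -> Ck_on k U g ->
  Ck_on k U (fun x => mink (f x) (g x)).
Proof.
move=> oU /(Ck_on_coordP _ _ oU) fk /(Ck_on_coordP _ _ oU) gk.
apply: (@Ck_on_ext _ _ _ _ _ _ _ oU (fun x _ => esym (mink_sum (f x) (g x)))).
apply: Ck_on_sum => // i _; apply: Ck_onM => //; first exact: Ck_on_cst.
exact: Ck_onM.
Qed.

Lemma derive_mink f g x v : differentiable f x -> differentiable g x ->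
  'D_v (fun y => mink (f y) (g y)) x =
  mink ('D_v f x) (g x) + mink (f x) ('D_v g x).
Proof.
move=> df dg; under eq_fun do rewrite mink_sum.
have fc i : derivable (fun y => f y 0 i) x v.
  by apply: diff_derivable; move/differentiable_coordP : df.
have gc i : derivable (fun y => g y 0 i) x v.
  by apply: diff_derivable; move/differentiable_coordP : dg.
pose h (i : 'I_4) := (-1) ^+ (i == ord_max) *:
  ((fun y => f y 0 i) * (fun y => g y 0 i)).
rewrite (_ : (fun y => _) = \sum_i h i); last first.
  by apply/funext => y; rewrite fct_sumE.
rewrite derive_sum; last by move=> i; apply: derivableZ; exact: derivableM.
rewrite !mink_sum -big_split; apply: eq_bigr => i _.
rewrite /h deriveZ; last exact: derivableM.
rewrite deriveM// -(derive_coord v i df) -(derive_coord v i dg) /GRing.scale/=.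
ring.
Qed.

Lemma derive_mink_height f p w x v : differentiable f x ->
  'D_v (fun y => mink (f y - p) w) x = mink ('D_v f x) w.
Proof.
move=> df; have dfp : differentiable (f - cst p) x by exact: differentiableB.
have -> : (fun y => mink (f y - p) w) = fun y => mink ((f - cst p) y) (cst w y).
  by [].
rewrite (derive_mink v dfp (differentiable_cst w x)) derive_cst mink0r addr0.
have -> // : 'D_v (f - cst p) x = 'D_v f x.
rewrite deriveB; [|exact: diff_derivable|exact: derivable_cst].
by rewrite derive_cst subr0.
Qed.

End MinkowskiCalculus.

(** * Charts of a surface and derivatives along it *)

Section Charts.
Context {R : realType}.
Local Notation R2 := 'rV[R]_2.
Local Notation R4 := 'rV[R]_4.
Variables (M : set R4).
Implicit Types (U : set R2) (phi : R2 -> R4).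

Lemma chart_mem U phi q : local_param M U phi -> U q -> M (phi q).
Proof.
move=> [oU _ _ _ opn] Uq; have [N _ UN] := opn U oU (fun _ => id).
have : (phi @` U) (phi q) by exists q.
by rewrite UN => -[].
Qed.

Lemma chart_diff U phi q : local_param M U phi -> U q -> differentiable phi q.
Proof. by move=> [_ /(_ 1%N)[+ _] _ _ _]; apply. Qed.

Lemma chart_derive_inj U phi q v w : local_param M U phi -> U q ->
  'D_v phi q = 'D_w phi q -> v = w.
Proof.
move=> cU Uq vw; have [_ _ imm _ _] := cU.
suff /(imm q _ Uq)/eqP : 'D_(v - w) phi q = 0 by rewrite subr_eq0 => /eqP.
rewrite -[v - w]addrC -scaleN1r derive_combo; last exact: chart_diff cU _.
by rewrite vw scaleN1r addNr.
Qed.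

(** The inverse of a chart is continuous because charts are open onto [M]; hence
    so is the transition map between two charts. *)
Lemma chart_transition U phi U' phi' q s : local_param M U phi ->
  local_param M U' phi' -> U q -> U' s -> phi q = phi' s ->
  exists t : R2 -> R2, [/\ t s = q, {for s, continuous t} &
    \forall y \near s, phi (t y) = phi' y].
Proof.
move=> cU cU' Uq U's qs; have [oU _ _ inj opn] := cU.
(* Injectivity of [phi] makes the choice below the only preimage. *)
pose t y := xget q [set q' | U q' /\ phi q' = phi' y].
have tE y q' : U q' -> phi q' = phi' y -> t y = q'.
  move=> Uq' e; have [/= Ut h] := @xgetPex _ q [set q | U q /\ phi q = phi' y]
    (ex_intro _ q' (conj Uq' e)).
  by apply: inj => //; rewrite e.
have near_t (V : set R2) : open V -> V `<=` U -> V q ->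
    \forall y \near s, V (t y) /\ phi (t y) = phi' y.
  move=> oV VU Vq; have [N oN VN] := opn V oV VU.
  have Os : N (phi' s).
    have : (phi @` V) (phi q) by exists q.
    by rewrite VN qs => -[].
  have cs : {for s, continuous phi'}.
    exact: differentiable_continuous (chart_diff cU' U's).
  have nO : nbhs s (phi' @^-1` N).
    by apply: cs; exact: open_nbhs_nbhs.
  have nU : nbhs s U'.
    by apply: open_nbhs_nbhs; split=> //; case: cU'.
  apply: filterS (filterI nO nU) => y [Oy U'y].
  have : (phi @` V) (phi' y) by rewrite VN; split=> //; exact: chart_mem cU' U'y.
  by move=> [q' Vq' e]; rewrite (tE y q' (VU _ Vq') e).
have ts : t s = q by exact: tE.
exists t; split=> //; last first.
  by apply: filterS (near_t U oU (fun _ => id) Uq) => y [].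
suff : t @ s --> q by rewrite -[in X in X -> _]ts.
move=> A; rewrite nbhsE => -[B [oB Bq] BA].
apply: filterS (near_t (B `&` U) (openI oB oU) (@subIsetr _ _ _) (conj Bq Uq)).
by move=> y [[/BA]].
Qed.

(** The transition map is differentiable because [phi] is an immersion, and the
    chain rule gives derivatives in one chart from those in the other. The same
    [L], the derivative of the transition map, works for all [F]; the case
    [F = id] compares the velocities. *)
Lemma change_chart U phi U' phi' q s : local_param M U phi ->
  local_param M U' phi' -> U q -> U' s -> phi q = phi' s ->
  exists L : R2 -> R2, forall (E : normedModType R) (F : R4 -> E),
    differentiable (F \o phi) q -> forall w,
    'D_w (F \o phi') s = 'D_(L w) (F \o phi) q.
Proof.
move=> cU cU' Uq U's qs; have [_ _ imm _ _] := cU.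
have [t [tq ct tphi]] := chart_transition cU cU' Uq U's qs.
have dphi := chart_diff cU Uq.
have dt : differentiable t s.
  apply: (@differentiable_lift _ _ _ _ phi) => //; rewrite ?tq//.
    by move=> v; exact: imm.
  apply: (near_eq_differentiable _ (chart_diff cU' U's)).
  by apply: filterS tphi => y /= ->.
exists (fun w => 'D_w t s) => E F dF w.
have -> : 'D_w (F \o phi') s = 'D_w ((F \o phi) \o t) s.
  by apply: near_eq_derive; apply: filterS tphi => y /= ->.
by rewrite derive_comp ?tq.
Qed.

(** The tangent plane, defined by all charts at once, can be computed in any one
    of them. *)
Lemma tangentP U phi q v : local_param M U phi -> U q ->
  tangent M (phi q) v <-> exists w, 'D_w phi q = v.
Proof.
move=> cU Uq; split=> [[U' [phi' [s [w [cU' U's sq <-]]]]]|[w wv]].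
  have [L LE] := change_chart cU cU' Uq U's (esym sq).
  by exists (L w); rewrite -(LE _ id)//; exact: chart_diff cU Uq.
by exists U, phi, q, w.
Qed.

(** Independence of the chart: two velocities with the same image have the same
    coordinates in a given chart, since it is an immersion. *)
Lemma deriv_alongE (E : normedModType R) (F : R4 -> E) U phi q w :
  smooth_along M F -> local_param M U phi -> U q ->
  deriv_along M F (phi q) ('D_w phi q) = 'D_w (F \o phi) q.
Proof.
move=> sF cU Uq; apply: xget_unique; first by exists U, phi, q, w.
move=> d [U' [phi' [s [w' [cU' U's sq ww' ->]]]]].
have dF : differentiable (F \o phi) q by case: (sF _ _ cU 1%N) => + _; apply.
have [L LE] := change_chart cU cU' Uq U's (esym sq).
rewrite LE//; congr ('D__ _ _); apply: (chart_derive_inj cU Uq).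
by rewrite -(LE _ id)//; exact: chart_diff cU Uq.
Qed.

Lemma tangent_combo p a u v : surface M -> M p ->
  tangent M p u -> tangent M p v -> tangent M p (a *: u + v).
Proof.
move=> sM Mp; have [U [phi [cU [q Uq <-]]]] := sM p Mp.
move=> /(tangentP _ cU Uq)[w <-] /(tangentP _ cU Uq)[w' <-].
apply/(tangentP _ cU Uq); exists (a *: w + w').
by rewrite derive_combo//; exact: chart_diff cU Uq.
Qed.

Lemma eq_smooth_along (E : normedModType R) (F G : R4 -> E) :
  (forall p, M p -> F p = G p) -> smooth_along M F -> smooth_along M G.
Proof.
move=> FG sF U phi cU k; have [oU _ _ _ _] := cU.
by apply: Ck_on_ext (sF U phi cU k) => // q Uq /=; rewrite FG//; exact: chart_mem cU Uq.
Qed.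

End Charts.

(** * Tangent part of a field along a spacelike surface *)

Section GramProjection.
Context {R : realType}.
Implicit Types e z : 'rV[R]_4.

Definition gram_det e1 e2 : R :=
  mink e1 e1 * mink e2 e2 - mink e1 e2 * mink e1 e2.

(** Cramer's rule for the normal equations of the orthogonal projection of [z]
    onto the plane spanned by [e1] and [e2]. *)
Definition gram_proj z e1 e2 : 'rV[R]_4 :=
  ((mink z e1 * mink e2 e2 - mink z e2 * mink e1 e2) / gram_det e1 e2) *: e1 +
  ((mink z e2 * mink e1 e1 - mink z e1 * mink e1 e2) / gram_det e1 e2) *: e2.

(** Orthogonalizing [e2] against [e1] gives a vector of squared length
    [gram_det e1 e2 / mink e1 e1]. *)
Lemma gram_det_neq0 e1 e2 : 0 < mink e1 e1 ->
  (forall a, 0 < mink (a *: e1 + e2) (a *: e1 + e2)) -> gram_det e1 e2 != 0.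
Proof.
move=> e10 /(_ (- mink e1 e2 / mink e1 e1)); rewrite /gram_det !minkE.
rewrite (minkC e2 e1); move: e10.
set g11 := mink e1 e1; set g12 := mink e1 e2; set g22 := mink e2 e2.
move=> g0 H; have : 0 < (g11 * g22 - g12 * g12) / g11.
  by congr (0 < _): H; field; rewrite gt_eqF.
by rewrite pmulr_lgt0 ?invr_gt0// => /gt_eqF ->.
Qed.

Lemma gram_proj_orth z e1 e2 a b : gram_det e1 e2 != 0 ->
  mink (z - gram_proj z e1 e2) (a *: e1 + b *: e2) = 0.
Proof.
rewrite /gram_proj /gram_det => G0; rewrite !minkE (minkC e2 e1).
move: G0; set g11 := mink e1 e1; set g12 := mink e1 e2; set g22 := mink e2 e2.
by move=> G0; field.
Qed.

Lemma gram_proj_coord z e1 e2 j : gram_proj z e1 e2 0 j =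
  (mink z e1 * mink e2 e2 - mink z e2 * mink e1 e2) / gram_det e1 e2 * e1 0 j +
  (mink z e2 * mink e1 e1 - mink z e1 * mink e1 e2) / gram_det e1 e2 * e2 0 j.
Proof. by rewrite !mxE. Qed.

End GramProjection.

Section TangentPart.
Context {R : realType}.
Local Notation R2 := 'rV[R]_2.
Local Notation R4 := 'rV[R]_4.
Variables (M : set R4) (Z : R4 -> R4).
Hypotheses (sM : surface M) (slM : spacelike M).
Implicit Types (U : set R2) (phi : R2 -> R4).

Lemma spacelike_null p v : M p -> tangent M p v -> mink v v = 0 -> v = 0.
Proof.
move=> Mp tv v0; apply/eqP; apply: contraT => /(slM Mp tv).
by rewrite v0 ltxx.
Qed.

Lemma tan_part_unique p t t' : M p ->
  tangent M p t -> (forall v, tangent M p v -> mink (Z p - t) v = 0) ->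
  tangent M p t' -> (forall v, tangent M p v -> mink (Z p - t') v = 0) -> t = t'.
Proof.
move=> Mp tt Ht tt' Ht'; apply/eqP; rewrite -subr_eq0; apply/eqP.
have td : tangent M p (t - t').
  by rewrite addrC -scaleN1r; exact: tangent_combo.
apply: (spacelike_null Mp td).
rewrite -[X in mink X _](_ : (Z p - t') - (Z p - t) = _).
  by rewrite minkBl Ht// Ht'// subrr.
by rewrite opprB addrC subrKA.
Qed.

Lemma chart_gram_det U phi q : local_param M U phi -> U q ->
  gram_det ('D_(delta_mx 0 0) phi q) ('D_(delta_mx 0 1) phi q) != 0.
Proof.
move=> cU Uq; have Mq := chart_mem cU Uq; have dphi := chart_diff cU Uq.
have pos w : w != 0 -> 0 < mink ('D_w phi q) ('D_w phi q).
  move=> w0; apply: (slM Mq); first by apply/(tangentP _ cU Uq); exists w.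
  by apply: contra w0 => /eqP; case: cU => _ _ imm _ _ /(imm q _ Uq) ->.
apply: gram_det_neq0 => [|a]; last rewrite -derive_combo//; apply: pos.
  by apply/eqP => /rowP/(_ 0); rewrite !mxE/= => /eqP; rewrite oner_eq0.
apply/eqP => /rowP/(_ 1); rewrite !mxE/= mulr0 add0r => /eqP.
by rewrite oner_eq0.
Qed.

Lemma gram_projP U phi q z : local_param M U phi -> U q ->
  let t := gram_proj z ('D_(delta_mx 0 0) phi q) ('D_(delta_mx 0 1) phi q) in
  tangent M (phi q) t /\ forall v, tangent M (phi q) v -> mink (z - t) v = 0.
Proof.
move=> cU Uq /=; have G0 := chart_gram_det cU Uq.
have te w : tangent M (phi q) ('D_w phi q).
  by apply/(tangentP _ cU Uq); exists w.
have Mq := chart_mem cU Uq; split.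
  apply: tangent_combo => //; rewrite -[_ *: _]addr0; apply: tangent_combo => //.
  by rewrite -(derive0 phi q).
move=> v /(tangentP _ cU Uq)[w <-].
have -> : 'D_w phi q = w 0 0 *: 'D_(delta_mx 0 0) phi q +
    w 0 1 *: 'D_(delta_mx 0 1) phi q.
  by apply: derive_row2; exact: chart_diff cU Uq.
exact: gram_proj_orth.
Qed.

Lemma tan_partP p : M p -> tangent M p (tan_part M Z p) /\
  forall v, tangent M p v -> mink (nor_part M Z p) v = 0.
Proof.
move=> Mp; have [U [phi [cU [q Uq qp]]]] := sM Mp.
have := gram_projP (Z p) cU Uq; rewrite qp => tP.
exact: (@xgetPex _ 0 [set t | tangent M p t /\
  forall v, tangent M p v -> mink (Z p - t) v = 0] (ex_intro _ _ tP)).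
Qed.

(** The explicit projection formula shows that the tangent part depends smoothly
    on the point, the Gram determinant of the coordinate frame being nonzero. *)
Lemma tan_part_field : smooth_along M Z -> tangent_field M (tan_part M Z).
Proof.
move=> sZ; split=> [U phi cU k|p /tan_partP[]//]; have [oU sphi _ _ _] := cU.
pose e i q := 'D_(delta_mx 0 i) phi q.
apply: (@Ck_on_ext _ _ _ _ _ (fun q => gram_proj (Z (phi q)) (e 0 q) (e 1 q))) => //.
  move=> q Uq /=; have Mq := chart_mem cU Uq.
  have [t1 t2] := gram_projP (Z (phi q)) cU Uq; have [t3 t4] := tan_partP Mq.
  exact: (tan_part_unique Mq).
have ek i : Ck_on k U (e i) by exact: Ck_on_derive (sphi k.+1).
have zk : Ck_on k U (fun q => Z (phi q)) by exact: sZ cU k.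
have gk i j : Ck_on k U (fun q => mink (e i q) (e j q)) by exact: Ck_on_mink.
have zek i : Ck_on k U (fun q => mink (Z (phi q)) (e i q)) by exact: Ck_on_mink.
have dk : Ck_on k U (fun q => (gram_det (e 0 q) (e 1 q))^-1).
  apply: Ck_onV => //; first by move=> q Uq; exact: chart_gram_det cU Uq.
  by apply: Ck_onB => //; exact: Ck_onM.
apply/Ck_on_coordP => // j.
have ekj i : Ck_on k U (fun q => e i q 0 j).
  by have /(Ck_on_coordP _ _ oU) := ek i; exact.
apply: (Ck_on_ext oU (fun q _ => esym (gram_proj_coord _ _ _ j))).
by apply: Ck_onD => //; apply: Ck_onM => //; apply: Ck_onM => //;
  apply: Ck_onB => //; exact: Ck_onM.
Qed.

End TangentPart.

(** * Differentiation of vector fields along a surface *)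

Section TangentDerivatives.
Context {R : realType}.
Local Notation R2 := 'rV[R]_2.
Local Notation R4 := 'rV[R]_4.
Variables (M : set R4).
Implicit Types (U : set R2) (phi : R2 -> R4).

Lemma smooth_along_diff (E : normedModType R) (F : R4 -> E) U phi q :
  smooth_along M F -> local_param M U phi -> U q -> differentiable (F \o phi) q.
Proof. by move=> sF cU Uq; case: (sF _ _ cU 1%N) => + _; apply. Qed.

Lemma smooth_along_coord (F : R4 -> R4) i :
  smooth_along M F -> smooth_along M (fun r => F r 0 i).
Proof.
move=> sF U phi cU k; have [oU _ _ _ _] := cU.
by have /(Ck_on_coordP _ _ oU) := sF U phi cU k; exact.
Qed.

Lemma smooth_along_id : smooth_along M id.
Proof. by move=> U phi []. Qed.

Lemma deriv_along_coord (F : R4 -> R4) i U phi q w :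
  smooth_along M F -> local_param M U phi -> U q ->
  deriv_along M (fun r => F r 0 i) (phi q) ('D_w phi q) =
  ('D_w (F \o phi) q) 0 i.
Proof.
move=> sF cU Uq; rewrite (deriv_alongE w (smooth_along_coord i sF) cU Uq).
by rewrite derive_coord//; exact: smooth_along_diff cU Uq.
Qed.

Lemma eq_deriv_along (E : normedModType R) (F G : R4 -> E) U phi q w :
  (forall p, M p -> F p = G p) -> smooth_along M F ->
  local_param M U phi -> U q ->
  deriv_along M G (phi q) ('D_w phi q) = 'D_w (F \o phi) q.
Proof.
move=> FG sF cU Uq; have [oU _ _ _ _] := cU.
rewrite (deriv_alongE w (eq_smooth_along FG sF) cU Uq).
apply: near_eq_derive; apply: filterS (open_nbhs_nbhs (conj oU Uq)) => y Uy /=.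
by rewrite FG//; exact: chart_mem cU Uy.
Qed.

(** Applied to the four coordinate functions of the ambient space, the torsion
    identity says that [nabla X Y - nabla Y X] is the ambient difference
    [D_X Y - D_Y X], which is therefore tangent. *)
Lemma torsion_free (nabla : (R4 -> R4) -> (R4 -> R4) -> R4 -> R4) X Y U phi q v w :
  surface M -> levi_civita M nabla -> tangent_field M X -> tangent_field M Y ->
  local_param M U phi -> U q -> 'D_v phi q = X (phi q) -> 'D_w phi q = Y (phi q) ->
  'D_v (Y \o phi) q - 'D_w (X \o phi) q =
  nabla X Y (phi q) - nabla Y X (phi q).
Proof.
move=> sM [nT _ _ tor _] tX tY cU Uq vX wY; have Mq := chart_mem cU Uq.
have dcoord p i u : M p -> tangent M p u ->
    deriv_along M (fun r : R4 => r 0 i) p u = u 0 i.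
  move=> Mp; have [U' [phi' [cU' [s U's <-]]]] := sM p Mp.
  move=> /(tangentP _ cU' U's)[z <-].
  by rewrite (deriv_along_coord i z smooth_along_id cU' U's).
apply/rowP => i; have [[sX tX'] [sY tY']] := (tX, tY).
have := tor X Y (fun r => r 0 i) _ tX tY (smooth_along_coord i smooth_along_id) Mq.
rewrite !dcoord//; [|by case: (nT _ _ tY tX) => _; apply
  |by case: (nT _ _ tX tY) => _; apply].
rewrite -vX -wY.
rewrite (eq_deriv_along v _ (smooth_along_coord i sY) cU Uq); last first.
  by move=> p Mp; rewrite dcoord//; exact: tY'.
rewrite (eq_deriv_along w _ (smooth_along_coord i sX) cU Uq); last first.
  by move=> p Mp; rewrite dcoord//; exact: tX'.
rewrite !mxE => ->; congr (_ - _); apply: derive_coord.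
  exact: smooth_along_diff cU Uq.
exact: smooth_along_diff cU Uq.
Qed.

End TangentDerivatives.

(** * Derivatives of the tangent part of a parallel null-normal field *)

Section Weingarten.
Context {R : realType}.
Local Notation R2 := 'rV[R]_2.
Local Notation R4 := 'rV[R]_4.
Variables (M : set R4) (nabla : (R4 -> R4) -> (R4 -> R4) -> R4 -> R4)
  (Z W : R4 -> R4) (beta : R4 -> R4 -> R).
Hypotheses (sM : surface M) (slM : spacelike M) (nablaP : levi_civita M nabla)
  (Zpar : parallel Z) (Zunit : forall p, mink (Z p) (Z p) = 1)
  (Znull : canonical_normal_null_direction M Z).
Hypotheses (tW : tangent_field M W)
  (WW : forall p, M p -> mink (W p) (W p) = 1)
  (TW : forall p, M p -> mink (tan_part M Z p) (W p) = 0).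
Hypotheses (betaP : is_beta M nabla Z beta)
  (a0 : forall p, M p -> a_function M nabla Z W p = 0)
  (beta0 : forall p, M p -> beta p (tan_part M Z p) = 0).
Local Notation T := (tan_part M Z).
Local Notation N := (nor_part M Z).

Lemma smooth_along_parallel : smooth_along M Z.
Proof.
move=> U phi cU k; apply: (@Ck_on_ext _ _ _ _ _ (fun=> Z 0)).
- by case: cU.
- by move=> q _; rewrite /= (parallel_cst (phi q)).
- exact: Ck_on_cst.
Qed.

Let tT : tangent_field M T.
Proof. exact: tan_part_field sM slM smooth_along_parallel. Qed.

Lemma nor_part_tangent p v : M p -> tangent M p v -> mink (N p) v = 0.
Proof. by move=> Mp; case: (tan_partP Z sM slM Mp) => _; apply. Qed.

Lemma nor_part_sq p : M p -> mink (N p) (N p) = 0.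
Proof. by move=> /Znull[]. Qed.

Lemma nor_part_T p : M p -> mink (N p) (T p) = 0.
Proof. by move=> Mp; apply: nor_part_tangent => //; exact: tT.2. Qed.

Lemma nor_part_W p : M p -> mink (N p) (W p) = 0.
Proof. by move=> Mp; apply: nor_part_tangent => //; exact: tW.2. Qed.

Lemma tan_nor p : Z p = T p + N p.
Proof. by rewrite /nor_part addrC subrK. Qed.

Lemma tan_part_unit p : M p -> mink (T p) (T p) = 1.
Proof.
move=> Mp; have := Zunit p; rewrite tan_nor minkDl 2!minkDr nor_part_sq//.
by rewrite nor_part_T// minkC nor_part_T// !addr0.
Qed.

(** Orthogonality to [N], [T] and [W] forces a multiple of [N], which is null, and
    a spacelike plane contains no other null vector than 0. *)
Lemma tangent_frame0 p v : M p -> tangent M p v ->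
  mink v (T p) = 0 -> mink v (W p) = 0 -> v = 0.
Proof.
move=> Mp tv vT vW.
have [c vE] : exists c, v = c *: N p.
  apply: (@null_normal_line _ _ (T p) (W p)) => //.
  - by case: (Znull Mp).
  - exact: nor_part_sq.
  - exact: nor_part_T.
  - exact: nor_part_W.
  - exact: tan_part_unit.
  - exact: WW.
  - exact: TW.
  - by rewrite minkC; exact: nor_part_tangent.
by apply: (spacelike_null slM Mp tv); rewrite vE minkZl minkZr nor_part_sq// !mulr0.
Qed.

Lemma tangent_frame p v : M p -> tangent M p v ->
  v = mink v (T p) *: T p + mink v (W p) *: W p.
Proof.
move=> Mp tv; apply/eqP; rewrite -subr_eq0; apply/eqP.
apply: (tangent_frame0 Mp).
- rewrite opprD -!scaleNr addrC -addrA.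
  by apply: tangent_combo => //; [exact: tT.2|apply: tangent_combo => //; exact: tW.2].
- by rewrite !minkE tan_part_unit// (minkC (W p)) TW//; ring.
- by rewrite !minkE WW// TW//; ring.
Qed.

Section InChart.
Variables (U : set R2) (phi : R2 -> R4) (q : R2).
Hypotheses (cU : local_param M U phi) (Uq : U q).
Let oU : open U. Proof. by case: cU. Qed.
Let Mphi x : U x -> M (phi x). Proof. exact: chart_mem cU. Qed.
Let Mq : M (phi q). Proof. exact: Mphi. Qed.
Let dT : differentiable (T \o phi) q.
Proof. exact: smooth_along_diff tT.1 cU Uq. Qed.
Let dW : differentiable (W \o phi) q.
Proof. exact: smooth_along_diff tW.1 cU Uq. Qed.

Lemma derive_T_T v : mink ('D_v (T \o phi) q) (T (phi q)) = 0.
Proof.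
have := derive_cst_on v oU Uq (fun x Ux => tan_part_unit (Mphi Ux)).
rewrite (@derive_mink _ _ (T \o phi) (T \o phi))//= [X in _ + X]minkC; lra.
Qed.

(** Since [Z = T + N] is constant, differentiating [mink W Z = 0] and
    [mink T W = 0] moves the derivative from [W] to [T]. *)
Lemma derive_W_N v :
  mink ('D_v (W \o phi) q) (N (phi q)) = mink ('D_v (T \o phi) q) (W (phi q)).
Proof.
have WZ x : U x -> mink (W (phi x)) (Z 0) = 0.
  move=> Ux; rewrite -(parallel_cst (phi x) Zpar) tan_nor minkDr minkC TW; last exact: Mphi.
  by rewrite minkC nor_part_W ?addr0//; exact: Mphi.
have := derive_cst_on v oU Uq WZ.
rewrite (@derive_mink _ _ (W \o phi) (fun=> Z 0))// derive_cst mink0r addr0.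
rewrite -(parallel_cst (phi q) Zpar) tan_nor minkDr.
have := derive_cst_on v oU Uq (fun x Ux => TW (Mphi Ux)).
rewrite (@derive_mink _ _ (T \o phi) (W \o phi))//= (minkC (T (phi q))); lra.
Qed.

Lemma second_ffE X Y v : tangent_field M Y -> 'D_v phi q = X (phi q) ->
  second_ff M nabla X Y (phi q) = 'D_v (Y \o phi) q - nabla X Y (phi q).
Proof. by move=> tY vX; rewrite /second_ff -vX (deriv_alongE v tY.1 cU Uq). Qed.

Let nablaT X Y : tangent_field M X -> tangent_field M Y ->
  tangent M (phi q) (nabla X Y (phi q)).
Proof. by move=> tX tY; case: nablaP => nT _ _ _ _; exact: (nT X Y tX tY).2. Qed.

(** The condition [a = 0] says that [D_W W] is orthogonal to [N], that is, [D_W T]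
    is orthogonal to [W]. As [T] has constant length, the tangent part of [D_W T]
    vanishes, and its normal part is the one given by [beta]. *)
Lemma derive_T_along_W v : 'D_v phi q = W (phi q) ->
  nabla W T (phi q) = 0 /\
  'D_v (T \o phi) q = beta (phi q) (W (phi q)) *: N (phi q).
Proof.
move=> vW; have := betaP tW Mq; rewrite (second_ffE tT vW).
set b := beta _ _ => /eqP; rewrite subr_eq => /eqP DE.
have TWv : mink ('D_v (T \o phi) q) (W (phi q)) = 0.
  rewrite -derive_W_N; have := a0 Mq.
  rewrite /a_function (second_ffE tW vW) minkBl.
  by rewrite (minkC (nabla _ _ _)) nor_part_tangent ?subr0//; exact: nablaT.
have n0 : nabla W T (phi q) = 0.
  apply: (tangent_frame0 Mq); first exact: nablaT.
    have := derive_T_T v.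
    by rewrite DE minkDl minkZl nor_part_T// mulr0 add0r.
  move: TWv; rewrite DE minkDl minkZl nor_part_W// mulr0 add0r; exact.
by split=> //; rewrite DE n0 addr0.
Qed.

(** The condition [beta T = 0] makes [D_T T] tangent, and constancy of the length
    of [T] makes it orthogonal to [T]. Its product with [W] is that of [D_T W]
    with [N], which by absence of torsion is that of [D_W T] with [N], hence zero. *)
Lemma derive_T_along_T v w : 'D_v phi q = T (phi q) -> 'D_w phi q = W (phi q) ->
  'D_v (T \o phi) q = 0.
Proof.
move=> vT wW; have [n0 DE] := derive_T_along_W wW.
have tD : tangent M (phi q) ('D_v (T \o phi) q).
  have := betaP tT Mq; rewrite (second_ffE tT vT) beta0// scale0r => /eqP.
  by rewrite subr_eq0 => /eqP ->; exact: nablaT.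
apply: (tangent_frame0 Mq tD (derive_T_T v)); rewrite -derive_W_N.
have := torsion_free sM nablaP tT tW cU Uq vT wW; rewrite n0 subr0 => /eqP.
rewrite subr_eq => /eqP ->; rewrite minkDl DE minkZl nor_part_sq// mulr0 addr0.
by rewrite minkC nor_part_tangent//; exact: nablaT.
Qed.

(** Both conclusions follow from the two derivatives of [T] along the frame
    [T], [W] by linearity. The second one says that the integral curves of [T] are
    straight lines. *)
Theorem derive_tan_part :
  (forall v, exists c, 'D_v (T \o phi) q = c *: N (phi q)) /\
  (forall v, 'D_v phi q = T (phi q) -> 'D_v (T \o phi) q = 0).
Proof.
have dphi := chart_diff cU Uq.
have [t tE] : exists t, 'D_t phi q = T (phi q).
  by apply/(tangentP _ cU Uq); exact: tT.2.
have [s sE] : exists s, 'D_s phi q = W (phi q).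
  by apply/(tangentP _ cU Uq); exact: tW.2.
split=> [v|v vT]; last exact: derive_T_along_T vT sE.
have [_ Ds] := derive_T_along_W sE; have Dt := derive_T_along_T tE sE.
have tv : tangent M (phi q) ('D_v phi q) by apply/(tangentP _ cU Uq); exists v.
have := tangent_frame Mq tv; set a := mink _ (T _); set b := mink _ (W _) => vE.
have -> : v = a *: t + b *: s.
  by apply: (chart_derive_inj cU Uq); rewrite (derive_lin2 a b t s dphi) tE sE.
exists (b * beta (phi q) (W (phi q))).
by rewrite (derive_lin2 a b t s dT) Dt Ds scaler0 add0r scalerA.
Qed.

End InChart.
End Weingarten.

(** * Changing charts *)

Section ChartChanges.
Context {R : realType}.
Local Notation R2 := 'rV[R]_2.
Local Notation R4 := 'rV[R]_4.
Variables (M : set R4).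
Implicit Types (U B Y : set R2) (phi psi : R2 -> R4).

Lemma local_param_sub U B phi : open B -> B `<=` U ->
  local_param M U phi -> local_param M B phi.
Proof.
move=> oB BU [oU sphi imm inj opn]; split=> //.
- by move=> k; exact: Ck_on_sub BU (sphi k).
- by move=> q v /BU; exact: imm.
- by move=> q q' /BU Uq /BU Uq'; exact: inj.
- by move=> V oV VB; apply: opn => //; exact: subset_trans VB BU.
Qed.

Lemma local_param_ext U phi psi : (forall q, U q -> phi q = psi q) ->
  local_param M U phi -> local_param M U psi.
Proof.
move=> e [oU sphi imm inj opn]; split=> //.
- by move=> k; exact: Ck_on_ext oU e (sphi k).
- move=> q v Uq D0; apply: (imm q) => //; rewrite -D0.
  apply: near_eq_derive; apply: filterS (open_nbhs_nbhs (conj oU Uq)).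
  exact: e.
- by move=> q q' Uq Uq'; rewrite -!e//; exact: inj.
- move=> V oV VU; have [P oP VP] := opn V oV VU; exists P => //.
  rewrite -VP; apply/seteqP; split=> _ [q Vq <-]; exists q => //.
    exact: e (VU q Vq).
  by rewrite e//; exact: VU.
Qed.

(** Composing with a local inverse [G] of [F] turns the functions [F] into
    coordinates. The image under [G] of an open set is its preimage under [F]
    inside [B], hence open. *)
Lemma local_param_comp U B Y phi (F G : R2 -> R2) : local_param M U phi ->
  open B -> B `<=` U -> (forall q, B q -> {for q, continuous F}) ->
  (forall a b, B a -> B b -> F a = F b -> a = b) ->
  open Y -> (forall y, Y y -> B (G y) /\ F (G y) = y) -> smooth_on Y G ->
  (forall y, Y y -> differentiable F (G y)) ->
  local_param M Y (phi \o G).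
Proof.
move=> cU oB BU cF injF oY GP sG dF; have [oU sphi imm inj opn] := cU.
have dG y : Y y -> differentiable G y.
  by move=> Yy; case: (sG 1%N) => + _; apply.
have UG y : Y y -> U (G y) by move=> /GP[/BU].
have FGE y : Y y -> \forall z \near y, F (G z) = z.
  by move=> Yy; apply: filterS (open_nbhs_nbhs (conj oY Yy)) => z /GP[].
split=> //.
- move=> k; apply/Ck_on_coordP => // j.
  apply: (@Ck_on_comp _ _ _ _ _ U G (fun q => phi q 0 j)) => //.
  by have /(Ck_on_coordP _ _ oU) := sphi k; exact.
- move=> y v Yy; rewrite derive_comp; last 2 first.
  + exact: dG.
  + exact: chart_diff cU (UG y Yy).
  move=> /(imm _ _ (UG y Yy)) DG0.
  have : 'D_v (F \o G) y = v by rewrite (near_eq_derive v (FGE y Yy)) derive_id.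
  rewrite derive_comp; [|exact: dG|exact: dF].
  by rewrite DG0 derive0.
- move=> y y' Yy Yy' /= e; have := inj _ _ (UG y Yy) (UG y' Yy') e.
  by move=> /(congr1 F); rewrite (GP y Yy).2 (GP y' Yy').2.
move=> V oV VY; pose V' := B `&` F @^-1` V.
have oV' : open V'.
  rewrite openE => q [Bq Vq]; apply: filterI; first exact: open_nbhs_nbhs.
  by apply: cF => //; exact: open_nbhs_nbhs.
have [P oP VP] := opn V' oV' (fun q H => BU q H.1).
exists P => //; rewrite -VP; apply/seteqP; split=> [_ [y Vy <-]|_ [q [Bq Vq] <-]].
  have [BG FG] := GP y (VY y Vy).
  by exists (G y) => //; split=> //=; rewrite FG.
have [BG FG] := GP _ (VY _ Vq).
by exists (F q) => //=; congr phi; exact: injF.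
Qed.

End ChartChanges.

(** * The ruling *)

Section Ruling.
Context {R : realType}.
Local Notation R2 := 'rV[R]_2.
Local Notation R4 := 'rV[R]_4.
Variables (M : set R4) (Z W : R4 -> R4).
Hypotheses (sM : surface M) (slM : spacelike M)
  (Zpar : parallel Z) (Zunit : forall p, mink (Z p) (Z p) = 1)
  (Znull : canonical_normal_null_direction M Z).
Hypotheses (tW : tangent_field M W)
  (WW : forall p, M p -> mink (W p) (W p) = 1)
  (TW : forall p, M p -> mink (tan_part M Z p) (W p) = 0).
Local Notation T := (tan_part M Z).
Local Notation N := (nor_part M Z).
Hypothesis derT : forall (U : set R2) phi q, local_param M U phi -> U q ->
  (forall v, exists c, 'D_v (T \o phi) q = c *: N (phi q)) /\
  (forall v, 'D_v phi q = T (phi q) -> 'D_v (T \o phi) q = 0).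

Let sT : smooth_along M T.
Proof. by case: (tan_part_field sM slM (smooth_along_parallel Zpar)). Qed.

Lemma derive_nor_part (U : set R2) phi q v : local_param M U phi -> U q ->
  differentiable (N \o phi) q /\ 'D_v (N \o phi) q = - 'D_v (T \o phi) q.
Proof.
move=> cU Uq; have dT := smooth_along_diff sT cU Uq.
have -> : N \o phi = cst (Z 0) - (T \o phi).
  by apply/funext => x /=; rewrite /nor_part (parallel_cst _ Zpar).
split; first exact: differentiableB.
rewrite deriveB; [|exact: derivable_cst|exact: diff_derivable].
by rewrite derive_cst sub0r.
Qed.

(** Every directional derivative of [N] is a multiple of [N], so the ratios of its
    coordinates to the last one have zero derivatives and are constant on a
    ball. A surface whose null normal has a constant direction lies in a null
    hyperplane. *)
Lemma nor_part_direction (q0 : R2) (rho : R) (phi : R2 -> R4) (p := phi q0) : 0 < rho ->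
  local_param M (ball q0 rho) phi ->
  forall q, ball q0 rho q ->
    N (phi q) = (N (phi q) 0 ord_max / N p 0 ord_max) *: N p.
Proof.
move=> rho0 cU q Bq; have Bq0 : ball q0 rho q0 by exact: ballxx.
have N4 x : ball q0 rho x -> N (phi x) 0 ord_max != 0.
  by move=> Bx; apply: lightlike_time_neq0; apply: Znull; exact: chart_mem cU Bx.
pose h j x := N (phi x) 0 j * (N (phi x) 0 ord_max)^-1.
have hq j : h j q = h j q0.
  apply/eqP; rewrite -subr_eq0; apply/eqP.
  have Dh x v : ball q0 rho x -> differentiable (h j) x /\ 'D_v (h j) x = 0.
    move=> Bx; have [dN DN] := derive_nor_part v cU Bx.
    have dNi i : differentiable (fun y => N (phi y) 0 i) x.
      by move/differentiable_coordP : dN; exact.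
    have [c DT] := (derT cU Bx).1 v.
    have DNi i : 'D_v (fun y => N (phi y) 0 i) x = - c * N (phi x) 0 i.
      have := derive_coord v i dN; rewrite DN DT -scaleNr mxE => <- //.
    pose a y := N (phi y) 0 j; pose b y := N (phi y) 0 ord_max.
    have bx : b x != 0 by exact: N4.
    have dV : differentiable (fun y => (b y)^-1) x.
      apply: (@differentiable_comp _ _ _ _ b (fun z => z^-1)).
        exact: dNi.
      exact: differentiable_Rinv.
    split; first exact: (differentiableM (dNi j) dV).
    rewrite deriveM; [|exact: diff_derivable (dNi j)|exact: diff_derivable dV].
    rewrite deriveV//; last exact: diff_derivable.
    rewrite !DNi /GRing.scale/= -/(b x); field.
    exact: bx.
  have [t t01|t t01 ->] := @mean_value_segment _ _ (h j) q0 q.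
    by have [] := Dh _ 0 (ball_segment Bq0 Bq t01).
  by have [] := Dh _ (q - q0) (ball_segment Bq0 Bq t01).
apply/rowP => j; rewrite [RHS]mxE; have := hq j; rewrite /h -/p => e.
apply: (mulIf (_ : (N (phi q) 0 ord_max)^-1 != 0)); first by rewrite invr_eq0 N4.
by rewrite e; field; rewrite (N4 _ Bq) (N4 _ Bq0).
Qed.

(** Let [n] be the fixed direction of [N] and [e = W p]. The functions
    [mink (phi - p) Z] and [mink (phi - p) e] have independent differentials: a
    tangent vector orthogonal to both [Z] and [e] is also orthogonal to [n], hence
    a multiple of [n], and tangent null vectors vanish. Use them as coordinates.
    The first coordinate field and [T] are tangent with the same products 1 with
    [Z] and 0 with [e], so they coincide by the same argument. *)
Lemma adapted_chart p : M p -> exists (r : R) (psi : R2 -> R4),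
  [/\ 0 < r, local_param M (ball 0 r) psi, psi 0 = p &
      forall y, ball 0 r y -> 'D_(delta_mx 0 0) psi y = T (psi y)].
Proof.
move=> Mp; have [U [phi [cU [q0 Uq0 q0p]]]] := sM Mp.
have [oU _ _ _ _] := cU.
have [rho rho0 BU] : exists2 rho : R, 0 < rho & ball q0 rho `<=` U.
  have /nbhs_ballP[rho] : nbhs q0 U by exact: open_nbhs_nbhs.
  by exists rho.
have {}cU := local_param_sub (ball_open q0 rho) BU cU.
move: BU Uq0 => _ _; have Bq0 : ball q0 rho q0 by exact: ballxx.
set U' := ball q0 rho in cU Bq0; have oU' : open U' by exact: ball_open.
have Mphi q : U' q -> M (phi q) by exact: chart_mem cU.
have dphi q : U' q -> differentiable phi q by exact: chart_diff cU.
pose n := N p; pose e := W p.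
have [n0 nn] : lightlike n by exact: Znull.
have Nn q : U' q -> exists2 c, c != 0 & N (phi q) = c *: n.
  move=> Bq; have := nor_part_direction rho0 cU Bq; rewrite q0p -/n => NE.
  eexists; last exact: NE.
  by rewrite mulf_neq0 ?invr_eq0// lightlike_time_neq0//; apply: Znull; exact: Mphi.
have tn q v : U' q -> tangent M (phi q) v -> mink v n = 0.
  move=> Bq tv; have [c c0 NE] := Nn q Bq.
  have := nor_part_tangent Z sM slM (Mphi q Bq) tv.
  by rewrite NE minkZl minkC => /eqP; rewrite mulf_eq0 (negPf c0) => /eqP.
have tD q v : U' q -> tangent M (phi q) ('D_v phi q).
  by move=> Bq; apply/(tangentP _ cU Bq); exists v.
have ZE q : Z (phi q) = Z 0 by exact: parallel_cst.
have zz : mink (Z 0) (Z 0) = 1 by exact: Zunit.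
have ee : mink e e = 1 by exact: WW.
have en : mink e n = 0 by rewrite minkC /n /e (nor_part_W Z sM slM tW Mp).
have zn : mink (Z 0) n = 0.
  rewrite -(ZE q0) q0p (tan_nor M Z) minkDl nn addr0 minkC.
  by rewrite /n (nor_part_T sM slM Zpar Mp).
have ze : mink (Z 0) e = 0.
  rewrite -(ZE q0) q0p (tan_nor M Z) minkDl /e TW// add0r.
  by rewrite (nor_part_W Z sM slM tW Mp).
have null0 q v : U' q -> tangent M (phi q) v -> mink v (Z 0) = 0 ->
    mink v e = 0 -> v = 0.
  move=> Bq tv vz ve.
  have [c vE] : exists c, v = c *: n.
    apply: (@null_normal_line _ _ (Z 0) e) => //; first by rewrite minkC.
    - by rewrite minkC.
    - exact: tn tv.
  apply: (spacelike_null slM (Mphi q Bq) tv).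
  by rewrite vE minkZl minkZr nn !mulr0.
pose F q : R2 := \row_j mink (phi q - p) (if j == 0 then Z 0 else e).
have F0 : F q0 = 0.
  by apply/rowP => j; rewrite !mxE q0p subrr mink0l.
have sphip k : Ck_on k U' (fun q => phi q - p).
  case: (cU) => _ sphi _ _ _.
  by apply: Ck_onD => //; exact: Ck_on_cst.
have sF : smooth_on U' F.
  move=> k; apply/Ck_on_coordP => // j.
  apply: (Ck_on_ext oU' (f := fun q => mink (phi q - p) (if j == 0 then Z 0 else e))).
    by move=> q _; rewrite mxE.
  by apply: Ck_on_mink => //; exact: Ck_on_cst.
have dF q : U' q -> differentiable F q by case: (sF 1%N) => + _; apply.
have DF q v j : U' q ->
    ('D_v F q) 0 j = mink ('D_v phi q) (if j == 0 then Z 0 else e).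
  move=> Bq; rewrite derive_coord; last exact: dF.
  rewrite (_ : (fun y => F y 0 j) =
      fun y => mink (phi y - p) (if j == 0 then Z 0 else e)); last first.
    by apply/funext => y; rewrite mxE.
  by apply: derive_mink_height; exact: dphi.
have immF q v : U' q -> 'D_v F q = 0 -> v = 0.
  move=> Bq DF0; case: (cU) => _ _ imm _ _; apply: (imm q) => //.
  apply: (null0 q) => //; first exact: tD.
    by have := DF q v 0 Bq; rewrite DF0 mxE.
  by have := DF q v 1 Bq; rewrite DF0 mxE.
have [B [r [G [r0 [oB Bq0' BU'] injF GP sG]]]] := inverse_function oU' Bq0 sF immF.
rewrite F0 in GP sG.
have cG : local_param M (ball 0 r) (phi \o G).
  apply: (@local_param_comp _ _ U' B (ball 0 r) phi F G) => //.
  - by move=> q /BU' Uq; apply: differentiable_continuous; exact: dF.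
  - exact: ball_open.
  - by move=> y /GP[/BU' Uy _]; exact: dF.
exists r, (phi \o G); split=> //.
  have [BG FG] := GP 0 (ballxx _ r0); rewrite /= -q0p; congr phi.
  by apply: injF => //; rewrite FG F0.
move=> y By; have [BG FG] := GP y By; have UG := BU' _ BG.
have dG : differentiable G y by case: (sG 1%N) => + _; apply.
(* The derivative of [G] is the inverse of that of [F], so the coordinate field
   [w] has products 1 and 0 with [Z] and [e]. *)
have DFG v : 'D_('D_v G y) F (G y) = v.
  rewrite -derive_comp//; last exact: dF.
  rewrite (@near_eq_derive _ _ _ _ id) ?derive_id//.
  by apply: filterS (open_nbhs_nbhs (conj (ball_open 0 r) By)) => z /GP[].
rewrite derive_comp//; last exact: dphi.
set w := 'D_(delta_mx 0 0) G y.
have tT : tangent M (phi (G y)) (T (phi (G y))).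
  by case: (tan_partP Z sM slM (Mphi _ UG)).
apply/eqP; rewrite -subr_eq0; apply/eqP; apply: (null0 (G y)) => //.
- rewrite addrC -scaleN1r; apply: tangent_combo => //; first exact: Mphi.
  exact: tD.
- have := DF (G y) w 0 UG; rewrite DFG mxE/= => e1.
  rewrite minkBl -e1 -(ZE (G y)) (tan_nor M Z) minkDr.
  rewrite (tan_part_unit sM slM Zpar Zunit Znull (Mphi _ UG)).
  by rewrite minkC (nor_part_tangent Z sM slM (Mphi _ UG) tT) addr0 subrr.
have := DF (G y) w 1 UG; rewrite DFG mxE/= => e1.
rewrite minkBl -e1 sub0r; have [c _ NE] := Nn _ UG.
have -> : T (phi (G y)) = Z 0 - c *: n.
  by rewrite -NE -(ZE (G y)) /nor_part opprB addrC subrK.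
by rewrite minkBl ze minkZl minkC en mulr0 subr0 oppr0.
Qed.

(** Along the first coordinate lines of the adapted chart the derivative of [psi]
    is [T] and that of [T] is zero, so [psi] is affine with constant
    velocity. *)
Lemma ruled_chart p : M p -> exists (r : R) (psi : R2 -> R4),
  [/\ 0 < r, local_param M (ball 0 r) psi, psi 0 = p &
      forall y, ball 0 r y -> psi y = psi (y 0 1 *: delta_mx 0 1) +
        y 0 0 *: T (psi (y 0 1 *: delta_mx 0 1))].
Proof.
move=> Mp; have [r [psi [r0 cpsi psi0 Dpsi]]] := adapted_chart Mp.
exists r, psi; split=> // y By; set y1 := y 0 1 *: _.
have yE : y - y1 = y 0 0 *: delta_mx 0 0 by rewrite [X in X - _]row2E addrK.
have y00 : (y - y1) 0 0 = y 0 0 by rewrite yE !mxE mulr1.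
have By1 : ball 0 r y1.
  move: By; rewrite -!ball_normE/= !sub0r !normrN; apply: le_lt_trans.
  apply: norm_le_coord => // j; rewrite !mxE.
  have [_|_] := eqVneq j 1; rewrite ?mulr1 ?mulr0 ?normr0//.
  exact: coord_le_norm.
have dT x : ball 0 r x -> differentiable (T \o psi) x.
  by move=> Bx; exact: smooth_along_diff sT cpsi Bx.
have dpsi x : ball 0 r x -> differentiable psi x.
  by move=> Bx; exact: chart_diff cpsi Bx.
have DZl (E : normedModType R) (f : R2 -> E) a x : differentiable f x ->
    'D_(a *: delta_mx 0 0) f x = a *: 'D_(delta_mx 0 0) f x.
  by move=> df; rewrite !deriveE// linearZ.
set c := T (psi y1).
have Tc t : 0 <= t <= 1 -> T (psi (y1 + t *: (y - y1))) = c.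
  move=> t01; have Bt := ball_segment By1 By t01.
  apply: (@derive0_eq _ _ _ (T \o psi) y1) => s s01.
  have Bs := ball_segment By1 Bt s01; split; first exact: dT.
  have dir : y1 + t *: (y - y1) - y1 = (t * y 0 0) *: delta_mx 0 0.
    by rewrite addrC addKr yE scalerA.
  rewrite [X in 'D_X _ _]dir (DZl _ _ _ _ (dT _ Bs)).
  by rewrite ((derT cpsi Bs).2 _ (Dpsi _ Bs)) scaler0.
pose h := psi - (fun x => x 0 0 *: c).
have dc x : differentiable (fun x : R2 => x 0 0 *: c) x.
  by apply: differentiableZl; exact: differentiable_coord.
have Dc x v : 'D_v (fun x : R2 => x 0 0 *: c) x = v 0 0 *: c.
  rewrite deriveE// diffZl; last exact: differentiable_coord.
  rewrite -deriveE; last exact: differentiable_coord.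
  by rewrite -(derive_coord _ _ (f := id))// derive_id.
have hE : h y = h y1.
  apply: derive0_eq => t t01; have Bt := ball_segment By1 By t01.
  split; first by apply: differentiableB => //; exact: dpsi.
  rewrite deriveB; last 2 first.
  - by apply: diff_derivable; exact: dpsi.
  - exact: diff_derivable.
  rewrite Dc y00 [X in 'D_X _ _]yE (DZl _ _ _ _ (dpsi _ Bt)).
  by rewrite Dpsi// Tc// subrr.
move: hE; rewrite /h !fctE => /eqP; rewrite subr_eq => /eqP ->.
by rewrite /y1 !mxE/= mulr0 scale0r subr0.
Qed.

End Ruling.

Theorem theorem1p19 (R : realType) (M : set 'rV[R]_4)
    (pos : 'rV[R]_4 -> 'rV[R]_4 -> 'rV[R]_4 -> Prop)
    (nabla : ('rV[R]_4 -> 'rV[R]_4) -> ('rV[R]_4 -> 'rV[R]_4) ->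
             'rV[R]_4 -> 'rV[R]_4)
    (Z W : 'rV[R]_4 -> 'rV[R]_4) (beta : 'rV[R]_4 -> 'rV[R]_4 -> R)
    (M_surface : surface M) (M_spacelike : spacelike M)
    (M_oriented : orientation M pos) (nablaP : levi_civita M nabla)
    (Z_parallel : parallel Z) (Z_unit : forall p, mink (Z p) (Z p) = 1)
    (Z_null : canonical_normal_null_direction M Z)
    (WP : unit_orthogonal_field M pos Z W)
    (betaP : is_beta M nabla Z beta)
    (a0 : forall p, M p -> a_function M nabla Z W p = 0)
    (beta0 : forall p, M p -> beta p (tan_part M Z p) = 0) :
  forall p, M p ->
  exists (e : R) (alpha : R -> 'rV[R]_4),
    [/\ 0 < e,
        smooth_on [set y : R | `|y| < e] alpha,
        alpha 0 = p,
        (forall y : R, `|y| < e -> M (alpha y)) &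
        local_param M
          [set q : 'rV[R]_2 | `|q 0 0| < e /\ `|q 0 1| < e]
          (fun q => alpha (q 0 1) + q 0 0 *: tan_part M Z (alpha (q 0 1)))].
Proof.
move=> p Mp; have [tW WP'] := WP.
have WW q : M q -> mink (W q) (W q) = 1 by case/WP'.
have TW q : M q -> mink (tan_part M Z q) (W q) = 0 by case/WP'.
have derT U phi q (cU : local_param M U phi) (Uq : U q) :=
  derive_tan_part M_surface M_spacelike nablaP Z_parallel Z_unit Z_null tW WW TW
    betaP a0 beta0 cU Uq.
have [r [psi [r0 cpsi psi0 ruled]]] :=
  ruled_chart M_surface M_spacelike Z_parallel Z_unit Z_null tW WW TW derT Mp.
have axis (y : R) : `|y| < r -> ball 0 r (y *: delta_mx 0 1 : 'rV[R]_2).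
  rewrite -ball_normE/= sub0r normrN; apply: le_lt_trans.
  apply: norm_le_coord => // j; rewrite !mxE.
  by have [_|_] := eqVneq j 1; rewrite ?mulr1 ?mulr0 ?normr0.
have sqE : [set q : 'rV[R]_2 | `|q 0 0| < r /\ `|q 0 1| < r] = ball 0 r.
  apply/seteqP; split=> q; rewrite -ball_normE/= sub0r normrN.
    move=> [q0r q1r]; apply: (@le_lt_trans _ _ (Num.max `|q 0 0| `|q 0 1|)).
      apply: norm_le_coord => [|j]; first by rewrite le_max normr_ge0.
      rewrite le_max; case: j => [[|[|//]]] j2.
        by rewrite (_ : Ordinal j2 = 0) ?lexx//; exact/val_inj.
      by rewrite (_ : Ordinal j2 = 1) ?lexx ?orbT//; exact/val_inj.
    by rewrite gt_max q0r.
  by move=> qr; split; apply: le_lt_trans qr; exact: coord_le_norm.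
have oY : open [set y : R | `|y| < r].
  rewrite (_ : [set _ | _] = ball (0 : R) r); first exact: ball_open.
  by apply/seteqP; split=> y; rewrite -ball_normE/= sub0r normrN.
exists r, (fun y => psi (y *: delta_mx 0 1)); split=> //.
- move=> k; apply/Ck_on_coordP => // j.
  have [oB spsi _ _ _] := cpsi.
  apply: (@Ck_on_comp _ _ _ _ _ _ (fun y : R => y *: delta_mx 0 1)
    (fun q => psi q 0 j) oY axis).
    apply/Ck_on_coordP => // i.
    apply: (@Ck_on_ext _ _ _ _ _ (fun y : R => y * (delta_mx 0 1 : 'rV[R]_2) 0 i)) => //.
      by move=> y _; rewrite [RHS]mxE.
    apply: Ck_onM => //; last exact: Ck_on_cst.
    exact: Ck_on_id.
  by have /(Ck_on_coordP _ _ oB) := spsi k; exact.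
- by rewrite scale0r.
- by move=> y yr; apply: (chart_mem cpsi); exact: axis.
rewrite sqE; apply: local_param_ext cpsi => y; exact: ruled.
Qed.
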